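(* Let $(\mathcal H,B)$ be an abstract Wiener space and $h>0$. Take $e_1\in B'$ with $|e_1|_{\mathcal H}=1$. For $a>0$ or $a=+\infty$, define $\tilde F_a$ on $B^2$ by $$\tilde F_a(z,\zeta)=\mathbf 1_{[0,a[}(\ell_{e_1}(\zeta))\ \mathbf 1_{[0,2\pi h a[}(\ell_{e_1}(z)),$$ where for $a=\infty$ both indicator functions are $\mathbf 1_{\mathbb R^+}$. Then, for $a>0$ sufficiently large or $a=\infty$, there exists a cylindrical function $\tilde v_a\in L^2(B,\mu_{B,h/2})$, belonging to $\mathcal D_{B',h/2}$, such that $$Q_h^{Weyl}(\tilde F_a)(\tilde v_a,\tilde v_a)=\int_{B^2}\tilde F_a(z,\zeta)\,W_{h,B}(\tilde v_a,\tilde v_a)(z,\zeta)\,d\mu_{B^2,h/2}(z,\zeta)>\|\tilde v_a\|^2_{L^2(B,\mu_{B,h/2})}.$$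
   Context: **Wiener space.** $\mathcal H$ is a real, separable, infinite dimensional Hilbert space with scalar product $\cdot$ and norm $|\ |$. $\mathcal F(X)$ is the set of finite dimensional subspaces of $X$. On a Euclidean space $E$ of dimension $d$, $\mu_{E,s}$ is the Gaussian measure $(2\pi s)^{-d/2}e^{-|y|^2/2s}dy$, $s>0$. For $E\in\mathcal F(\mathcal H)$, $P_E$ is the orthogonal projection on $E$; for a Borel set $A\subset E$, the cylinder $C=\{x\in\mathcal H: P_E(x)\in A\}$ has protomeasure $\mu_{\mathcal H,s}(C)=\mu_{E,s}(A)$. Let $\|\ \|$ be another norm on $\mathcal H$ which is measurable: for all $\epsilon>0$ there is $E_\epsilon\in\mathcal F(\mathcal H)$ such that $\mu_{\mathcal H,s}(\{x:\|P_F(x)\|>\epsilon\})<\epsilon$ for all $F\in\mathcal F(\mathcal H)$ with $F\perp E_\epsilon$. $B$ is the completion of $\mathcal H$ for $\|\ \|$, and $B'\subset\mathcal H\subset B$ (with $\mathcal H$ identified with its dual; inclusions continuous and dense). $(\mathcal H,B)$ is called an abstract Wiener space. $\mu_{B,s}$ is the probability measure on the Borel $\sigma$-algebra of $B$ such that $\mu_{B,s}(\{x\in B:((y_i,x)_{B',B})_{i\le n}\in A\})=\mu_{\mathcal H,s}(\{x\in\mathcal H:(y_i\cdot x)_{i\le n}\in A\})$ for $y_1,\dots,y_n\in B'$ and Borel $A\subset\mathbb R^n$. For $a\in B'$, $\ell_a(x)=(a,x)_{B',B}$. For $E\in\mathcal F(B')$ with basis $(u_j)$ orthonormal for the scalar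 product of $\mathcal H$, $\tilde\pi_E(y)=\sum_j\ell_{u_j}(y)u_j$ for $y\in B$. On $B^2$, $\mu_{B^2,s}=\mu_{B,s}\otimes\mu_{B,s}$. **Test functions, Wigner functions and quadratic form.** For $E$ of dimension $d$, $\gamma_{E,h/2}f(y)=(\pi h)^{-d/4}e^{-|y|^2/2h}f(y)$. $\mathcal S_{E,h/2}$ is the space of complex functions $\varphi$ on $E$ with $\gamma_{E,h/2}\varphi$ rapidly decreasing (Schwartz class). $\mathcal D_{B',h/2}$ is the set of functions $\tilde f=\varphi\circ\tilde\pi_E$ on $B$ with $E\in\mathcal F(B')$, $\varphi\in\mathcal S_{E,h/2}$ (cylindrical functions: they depend on finitely many variables). For $\hat f,\hat g\in\mathcal S_{E,h/2}$, $$W_{h,E}(\hat f,\hat g)(z,\zeta)=e^{|\zeta|^2/h}\int_E e^{-2i\zeta\cdot t/h}\hat f(z+t)\overline{\hat g(z-t)}e^{-|t|^2/h}(\pi h)^{-d/2}dt,\quad (z,\zeta)\in E^2,$$ and for $\tilde f=\hat f\circ\tilde\pi_E,\ \tilde g=\hat g\circ\tilde\pi_E$, $W_{h,B}(\tilde f,\tilde g)(z,\zeta)=W_{h,E}(\hat f,\hat g)(\tilde\pi_E(z),\tilde\pi_E(\zeta))$ for $(z,\zeta)\in B^2$ (independent of the choice of $E$; it belongs to $L^1(B^2,\mu_{B^2,h/2})$). For a bounded Borel function $\tilde F$ on $B^2$ and $\tilde f,\tilde g\in\mathcal D_{B',h/2}$, $Q_h^{Weyl}(\tilde F)(\tilde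 f,\tilde g)=\int_{B^2}\tilde F\,W_{h,B}(\tilde f,\tilde g)\,d\mu_{B^2,h/2}$. *)

(* Defs.v *)
From HB Require Import structures.
From mathcomp Require Import all_boot all_order all_algebra.
From mathcomp Require Import all_classical all_reals all_analysis.
From mathcomp Require Import complex.

Set Implicit Arguments.
Unset Strict Implicit.
Unset Printing Implicit Defensive.

Import Order.TTheory GRing.Theory Num.Theory.
Import numFieldNormedType.Exports.

Local Open Scope classical_set_scope.
Local Open Scope ring_scope.

(* Lebesgue measure on R^d, carried by d.-tuple R with its product
   sigma-algebra: Dirac mass for d = 0, then the image of
   (Lebesgue measure on R) \x (measure in dimension d) under
   (x, t) |-> x :: t. *)
Section lebesgue_tuple.
Context (R : realType).

Definition consT (d : nat) (p : measurableTypeR R * d.-tuple R) :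
  d.+1.-tuple R := [tuple of (p.1 : R) :: p.2].

Lemma measurable_consT d : measurable_fun setT (@consT d).
Proof. exact: (@measurable_cons _ _ _ _ fst d snd). Qed.

Section step.
Context (d : nat) (m : {sigma_finite_measure set (d.-tuple R) -> \bar R}).
Local Open Scope ereal_scope.

Definition lebesgue_consT : set (d.+1.-tuple R) -> \bar R :=
  pushforward (@lebesgue_measure R \x m) (@consT d).

Let preim_measurable (A : set (d.+1.-tuple R)) :
  measurable A -> measurable (@consT d @^-1` A).
Proof. by move=> mA; rewrite -[X in measurable X]setTI; exact: measurable_consT. Qed.

Let lebesgue_consT0 : lebesgue_consT set0 = 0.
Proof. by rewrite /lebesgue_consT /pushforward preimage_set0 measure0. Qed.

Let lebesgue_consT_ge0 A : 0 <= lebesgue_consT A.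
Proof. by rewrite /lebesgue_consT /pushforward. Qed.

Let lebesgue_consT_sigma_additive : semi_sigma_additive lebesgue_consT.
Proof.
move=> F mF tF mUF; rewrite /lebesgue_consT /pushforward preimage_bigcup.
apply: measure_semi_sigma_additive.
- by move=> n; exact: preim_measurable.
- apply/trivIsetP => /= i j _ _ ij; rewrite -preimage_setI.
  by move/trivIsetP : tF => /(_ _ _ _ _ ij) ->//; rewrite preimage_set0.
- by rewrite -preimage_bigcup; exact: preim_measurable.
Qed.

HB.instance Definition _ := isMeasure.Build _ _ _ lebesgue_consT
  lebesgue_consT0 lebesgue_consT_ge0 lebesgue_consT_sigma_additive.

Let lebesgue_consT_sigma_finite : sigma_finite setT lebesgue_consT.
Proof.
have /sigma_finiteP[F [TF ndF Foo]] := sigma_finiteT (@lebesgue_measure R).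
have /sigma_finiteP[G [TG ndG Goo]] := sigma_finiteT m.
pose unconsT (t : d.+1.-tuple R) : measurableTypeR R * d.-tuple R :=
  (thead t, [tuple of behead t]).
have munconsT : measurable_fun setT unconsT.
  apply/measurable_fun_pairP; split.
    exact: (@measurable_tnth _ R d.+1 ord0).
  exact: (@measurable_behead _ R d).
have consK : cancel (@consT d) unconsT.
  by case=> x t; congr pair => //; exact/val_inj.
exists (fun k => unconsT @^-1` (F k `*` G k)).
  apply/esym; rewrite -subTset => t _.
  have [i _ Fi] : (\bigcup_k F k) (thead t) by rewrite -TF.
  have [j _ Gj] : (\bigcup_k G k) [tuple of behead t] by rewrite -TG.
  exists (maxn i j) => //; split.
    by move: Fi; exact/subsetPset/ndF/leq_maxl.
  by move: Gj; exact/subsetPset/ndG/leq_maxr.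
move=> k; have [mF Fk] := Foo k; have [mG Gk] := Goo k; split.
  by rewrite -[X in measurable X]setTI; apply: munconsT => //; exact: measurableX.
rewrite /lebesgue_consT /pushforward -comp_preimage.
rewrite (_ : unconsT \o @consT d = id); last by apply/funext => p; exact: consK.
by rewrite preimage_id product_measure1E// lte_mul_pinfty// ge0_fin_numE.
Qed.

HB.instance Definition _ := @Measure_isSigmaFinite.Build _ _ _
  lebesgue_consT lebesgue_consT_sigma_finite.

End step.

Fixpoint lebesgue_tuple (d : nat) :
    {sigma_finite_measure set (d.-tuple R) -> \bar R} :=
  if d is d'.+1 then lebesgue_consT (lebesgue_tuple d')
  else \d_ ([tuple] : 0.-tuple R).

End lebesgue_tuple.

Local Open Scope complex_scope.

Definition cintegral d (T : measurableType d) (R : realType)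
    (mu : {measure set T -> \bar R}) (f : T -> R[i]) : R[i] :=
  (\int[mu]_x complex.Re (f x)) +i* (\int[mu]_x complex.Im (f x)).

Definition sqmod (R : realType) (z : R[i]) : R :=
  complex.Re z ^+ 2 + complex.Im z ^+ 2.

Definition isL2 d (T : measurableType d) (R : realType)
    (mu : {measure set T -> \bar R}) (f : T -> R[i]) : Prop :=
  [/\ measurable_fun setT (fun x => complex.Re (f x)),
      measurable_fun setT (fun x => complex.Im (f x)) &
      mu.-integrable setT (fun x => (sqmod (f x))%:E)].

Definition sqnormL2 d (T : measurableType d) (R : realType)
    (mu : {measure set T -> \bar R}) (f : T -> R[i]) : R :=
  \int[mu]_x sqmod (f x).

Section euclidean.
Context (R : realType).

Definition edot (d : nat) (x y : 'rV[R]_d) : R := \sum_j x 0 j * y 0 j.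

Definition gauss_density (s : R) (d : nat) (t : d.-tuple R) : R :=
  (2 * pi * s) `^ (- (d%:R / 2)) *
  expR (- (\sum_j tnth t j ^+ 2) / (2 * s)).

Definition gauss (s : R) (d : nat) (A : set (d.-tuple R)) : \bar R :=
  (\int[lebesgue_tuple R d]_(t in A) (gauss_density s t)%:E)%E.

Definition partials (d : nat) (l : seq 'I_d) (f : 'rV[R]_d -> R) :
    'rV[R]_d -> R :=
  foldr (fun i g x => 'D_(delta_mx 0 i) g x) f l.

(* Differentiability of all iterated partials is smoothness; `|x| is the sup
   norm on 'rV_d, which is equivalent to the Euclidean one. *)
Definition schwartz (d : nat) (f : 'rV[R]_d -> R) : Prop :=
  forall l : seq 'I_d,
    (forall x, differentiable (partials l f) x) /\
    (forall k : nat, exists M : R,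
       forall x, `|x| ^+ k * `|partials l f x| <= M).

(* gamma_{E,h/2}, S_{E,h/2} (test_fun) and D_{B',h/2} (cylindrical, below) are
   indexed by h and attached to the Gaussian measure of variance h / 2. *)
Definition gamma_fun (h : R) (d : nat) (f : 'rV[R]_d -> R[i]) (y : 'rV[R]_d) :
    R[i] :=
  ((pi * h) `^ (- (d%:R / 4)) * expR (- edot y y / (2 * h)))%:C * f y.

Definition test_fun (h : R) (d : nat) (f : 'rV[R]_d -> R[i]) : Prop :=
  schwartz (fun y => complex.Re (gamma_fun h f y)) /\
  schwartz (fun y => complex.Im (gamma_fun h f y)).

Definition expi (x : R) : R[i] := cos x +i* sin x.

Definition rV_of_tuple (d : nat) (t : d.-tuple R) : 'rV[R]_d :=
  \row_j tnth t j.

Definition wignerE (h : R) (d : nat) (f g : 'rV[R]_d -> R[i])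
    (z zeta : 'rV[R]_d) : R[i] :=
  (expR (edot zeta zeta / h))%:C *
  cintegral (lebesgue_tuple R d) (fun s =>
    let t := rV_of_tuple s in
    expi (- (2 * edot zeta t / h)) * f (z + t) * conjc (g (z - t)) *
    (expR (- edot t t / h) * (pi * h) `^ (- (d%:R / 2)))%:C).

End euclidean.

(* Real separable infinite-dimensional Hilbert space: a complete normed space
   whose norm comes from the scalar product dot. *)
Record hilbert (R : realType) := Hilbert {
  hil_space :> completeNormedModType R;
  dot : hil_space -> hil_space -> R;
  dotC : forall x y, dot x y = dot y x;
  dot_linear : forall y, scalar (fun x => dot x y);
  dot_norm : forall x, dot x x = `|x| ^+ 2;
  hil_separable : exists D : set hil_space, countable D /\ dense D;
  hil_infdim : ~ exists (n : nat) (u : 'I_n -> hil_space),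
    forall x, exists c : 'I_n -> R, x = \sum_i c i *: u i
}.

Section hilbert_theory.
Context (R : realType) (H : hilbert R).

(* A subspace E in F(H) of dimension d is presented by an orthonormal basis
   u : 'I_d -> H, which identifies E with R^d. *)
Definition orthonormal (d : nat) (u : 'I_d -> H) : Prop :=
  forall i j, dot (u i) (u j) = (i == j)%:R.

Definition orth_proj (d : nat) (u : 'I_d -> H) (x : H) : H :=
  \sum_j dot (u j) x *: u j.

(* C is a cylinder {x | P_E x \in A} and p = mu_{E,s}(A) is its
   protomeasure, computed in coordinates of E. *)
Definition is_protomeasure (s : R) (C : set H) (p : \bar R) : Prop :=
  exists (d : nat) (u : 'I_d -> H) (A : set (d.-tuple R)),
    [/\ orthonormal u, measurable A,
        C = [set x | A [tuple dot (u j) x | j < d]] & p = gauss s A].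

Definition measurable_norm (N : H -> R) : Prop :=
  forall s : R, 0 < s -> forall eps : R, 0 < eps ->
  exists (m : nat) (e : 'I_m -> H), orthonormal e /\
    forall (d : nat) (f : 'I_d -> H), orthonormal f ->
      (forall i j, dot (f i) (e j) = 0) ->
      exists2 p, is_protomeasure s [set x | eps < N (orth_proj f x)] p &
                 (p < eps%:E)%E.

End hilbert_theory.

(* B is the completion of H for the norm |iota x|: it is complete, and iota is
   isometric for that norm with dense range. *)
Record wienerSpace (R : realType) := WienerSpace {
  wH : hilbert R;
  wB : completeNormedModType R;
  iota : {linear wH -> wB};
  iota_inj : injective iota;
  iota_continuous : continuous iota;
  iota_dense : dense (range iota);
  iota_measurable : measurable_norm (fun x => `|iota x|)
}.

Section wiener_theory.
Context (R : realType) (W : wienerSpace R).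
Let H := wH W.
Let B := wB W.

(* l is the continuous functional on B that a represents through B' \subset H;
   it is determined by a since iota has dense range. *)
Definition represents (a : H) (l : B -> R) : Prop :=
  [/\ scalar l, continuous l & forall x, l (iota W x) = dot a x].

(* B' as a subset of H *)
Definition in_dual (a : H) : Prop := exists l, represents a l.

Definition ell (a : H) : B -> R := xget (fun=> 0) [set l | represents a l].

Definition borelB := g_sigma_algebraType (@open B).

(* mu = mu_{B,s} *)
Definition is_wiener_measure (s : R) (mu : probability borelB R) : Prop :=
  forall (n : nat) (y : 'I_n -> H) (A : set (n.-tuple R)) (p : \bar R),
    (forall i, in_dual (y i)) -> measurable A ->
    is_protomeasure s [set x | A [tuple dot (y i) x | i < n]] p ->
    mu [set x | A [tuple ell (y i) x | i < n]] = p.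

(* a subspace E in F(B') presented by an orthonormal basis *)
Definition dual_basis (d : nat) (u : 'I_d -> H) : Prop :=
  orthonormal u /\ forall j, in_dual (u j).

(* coordinates of pi~_E in the basis u of E *)
Definition tpi (d : nat) (u : 'I_d -> H) (y : B) : 'rV[R]_d :=
  \row_j ell (u j) y.

Definition cylindrical (h : R) (f : borelB -> R[i]) : Prop :=
  exists (d : nat) (u : 'I_d -> H) (phi : 'rV[R]_d -> R[i]),
    [/\ dual_basis u, test_fun h phi & f = phi \o tpi u].

(* W_{h,B}(f, g), through an arbitrary common representation of f and g; its
   value does not depend on the representation. *)
Definition wignerB (h : R) (f g : borelB -> R[i]) : borelB * borelB -> R[i] :=
  xget (fun=> 0) [set w |
    exists (d : nat) (u : 'I_d -> H) (phi psi : 'rV[R]_d -> R[i]),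
      [/\ dual_basis u,
          test_fun h phi /\ test_fun h psi,
          f = phi \o tpi u,
          g = psi \o tpi u &
          w = fun p => wignerE h phi psi (tpi u p.1) (tpi u p.2)]].

(* mu stands for mu_{B,h/2} *)
Definition Qweyl (mu : probability borelB R) (h : R)
    (F : borelB * borelB -> R[i]) (f g : borelB -> R[i]) : R[i] :=
  cintegral (mu \x mu)%E (fun p => F p * wignerB h f g p).

(* For a = +oo both indicators are those of [0, +oo[. *)
Definition Fa (e1 : H) (h : R) (a : \bar R) (p : borelB * borelB) : R[i] :=
  (\1_[set t : R | 0 <= t /\ (t%:E < a)%E] (ell e1 p.2) *
   \1_[set t : R | 0 <= t /\ (t%:E < (2 * pi * h)%:E * a)%E] (ell e1 p.1))%:C.

End wiener_theory.

(* Main.v *)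
From HB Require Import structures.
Require Import Defs.
From mathcomp Require Import all_boot all_order all_algebra.
From mathcomp Require Import all_classical all_reals all_analysis.
From mathcomp Require Import measurable_realfun normal_distribution.
From mathcomp Require Import complex ring lra.
Import Order.TTheory GRing.Theory Num.Theory.
Import numFieldNormedType.Exports.
Local Open Scope classical_set_scope.
Local Open Scope ring_scope.
Local Open Scope complex_scope.

(** Why the form exceeds the norm.

    For a state v = phi \o ell e1 everything happens in the phase plane of a
    single particle: the law of ell e1 is the centred Gaussian of variance
    h / 2 on the line, and the quadratic form is the integral of the Wigner
    function of phi over the quarter plane, or over a large rectangle in it.

    If this form never exceeded the squared norm, the Cauchy-Schwarz
    inequality for the difference would bound the cross term of two states
    by the geometric mean of their defects.  Two coherent states centred at
    the opposite points (L, L) and (- L, - L), in units of sqrt h, violate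
    this bound.  The first one lies deep inside the quarter plane and misses
    only an exponentially small part of its norm.  The second one lies
    outside, and its defect is about its norm.  Their cross Wigner function
    is an oscillating Gaussian centred at the midpoint, which is the corner
    of the quarter plane; because the corner is sharp, its integral decays
    only like 1 / L ^ 2.  Hence the sum of the first packet and a small
    positive multiple del of the second one gains about
    2 * del / (4 * pi * L ^ 2) - del ^ 2, relative to the squared norm
    exp (L ^ 2) of one packet, and loses only a multiple of exp (- L ^ 2).
    The values L = 10 and del = 10 ^ (- 4) suffice.

    Relative to the Gaussian measure the coherent states are exponentials,
    so phi s = exp ((1 + i) kap s) + del exp (- (1 + i) kap s) with
    kap = L / sqrt h ([profile]), and all integrals are explicit:
    [Rintegral_gwave] gives the Fourier transform of a Gaussian, which yields
    the Wigner function ([wignerE_profile]) and the norm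
    ([sqnormL2_packets]).  Both the Wigner function and the rectangle
    factorise, so the form is a polynomial in integrals over half-lines or
    intervals ([Qweyl_packets]).  For the infinite quarter plane these are
    bounded below in [gint_exp_half] and [gint_sin_half], the latter being
    the slow decay due to the sharp edge, and [quarter_form_limit_gt]
    collects the bounds.  Dominated convergence carries the strict
    inequality over to large rectangles ([quarter_form_gt]).

    The Wigner function on the Wiener space is defined through an arbitrary
    cylindrical representation phi \o tpi u of the state.  Since the profile
    is not constant, the span of u has to contain e1, and then phi is the
    profile composed with the scalar product by the unit vector k of the
    coordinates of e1 ([direction_in_span], [profile_direction]); the Wigner
    function is computed for such a phi in any dimension. *)

Set Implicit Arguments.
Unset Strict Implicit.
Unset Printing Implicit Defensive.

(** * Densities, truncations and products of integrals *)

Section density.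
Context d (T : measurableType d) (R : realType).
Variables (mu nu : {measure set T -> \bar R}) (rho : T -> R).
Hypothesis mrho : measurable_fun setT rho.
Hypothesis rho_ge0 : forall x, 0 <= rho x.
Hypothesis nuE : forall A, measurable A ->
  nu A = (\int[mu]_(x in A) (rho x)%:E)%E.
Local Open Scope ereal_scope.
Import HBNNSimple.

Lemma ge0_integral_density (f : T -> \bar R) :
  measurable_fun setT f -> (forall x, 0 <= f x) ->
  \int[nu]_x f x = \int[mu]_x (f x * (rho x)%:E).
Proof.
move=> mf f0; pose h := nnsfun_approx measurableT mf.
have cvh x : (h n x)%:E @[n --> \oo] --> f x.
  by apply: cvg_nnsfun_approx => //.
have -> : \int[nu]_x f x = limn (fun n => \int[nu]_x (h n x)%:E).
  rewrite -monotone_convergence//.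
  - by apply: eq_integral => x _; apply/esym/cvg_lim.
  - by move=> n; exact/measurable_EFinP/measurable_funP.
  - by move=> n x _; rewrite lee_fin.
  - by move=> x _ m n mn; rewrite lee_fin; exact/lefP/nd_nnsfun_approx.
have -> : \int[mu]_x (f x * (rho x)%:E)
    = limn (fun n => \int[mu]_x ((h n x)%:E * (rho x)%:E)).
  rewrite -monotone_convergence//.
  - apply: eq_integral => x _; apply/esym/cvg_lim => //.
    by apply: cvgeZr.
  - move=> n; apply: emeasurable_funM; apply/measurable_EFinP => //.
  - by move=> n x _; rewrite mule_ge0// lee_fin.
  - move=> x _ m n mn; rewrite lee_wpmul2r ?lee_fin//.
    exact/lefP/nd_nnsfun_approx.
congr (limn _); apply/funext => n.
transitivity (\sum_(y \in range (h n))
    \int[nu]_x (y * \1_(h n @^-1` [set y]) x)%:E).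
  rewrite -ge0_integral_fsum//.
  - by apply: eq_integral => x _; rewrite fsumEFin// -fimfunE.
  - by move=> y; exact/measurable_EFinP/measurable_funM.
  - by move=> y x _; exact: nnfun_muleindic_ge0.
transitivity (\sum_(y \in range (h n))
    \int[mu]_x ((y * \1_(h n @^-1` [set y]) x)%:E * (rho x)%:E)); last first.
  rewrite -ge0_integral_fsum//.
  - apply: eq_integral => x _.
    rewrite -ge0_mule_fsuml => [|y]; last exact: nnfun_muleindic_ge0.
    by rewrite fsumEFin// -fimfunE.
  - by move=> y; apply: emeasurable_funM; apply/measurable_EFinP => //;
      exact/measurable_funM.
  - by move=> y x _; rewrite mule_ge0// ?lee_fin//; exact: nnfun_muleindic_ge0.
apply: eq_fsbigr => r; rewrite inE => -[z _ <-].
have hz : (0 <= h n z)%R by [].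
under eq_integral do rewrite EFinM.
under [RHS]eq_integral do rewrite EFinM -muleA.
rewrite !ge0_integralZl//; last 3 first.
- by apply: emeasurable_funM; apply/measurable_EFinP.
- by move=> x _; rewrite mule_ge0// lee_fin.
- exact/measurable_EFinP.
congr (_ * _).
rewrite integral_indic// setIT nuE//.
rewrite [LHS]integral_mkcond; apply: eq_integral => x _.
by rewrite epatch_indic muleC.
Qed.

Lemma integrable_density (f : T -> R) : measurable_fun setT f ->
  mu.-integrable setT (EFin \o (f \* rho)%R) -> nu.-integrable setT (EFin \o f).
Proof.
move=> mf /integrableP[_ i]; apply/integrableP; split; first exact/measurable_EFinP.
rewrite ge0_integral_density//; last by apply: measurableT_comp => //; exact/measurable_EFinP.
apply: le_lt_trans i; rewrite le_eqVlt; apply/orP; left; apply/eqP.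
by apply: eq_integral => x _ /=; rewrite normrM EFinM (ger0_norm (rho_ge0 x)).
Qed.

Lemma Rintegral_density (f : T -> R) : measurable_fun setT f ->
  (\int[nu]_x f x = \int[mu]_x (f x * rho x))%R.
Proof.
move=> mf; rewrite /Rintegral; congr fine.
have mEf : measurable_fun setT (EFin \o f) by exact/measurable_EFinP.
rewrite integralE [RHS]integralE.
rewrite !ge0_integral_density//; [|exact: measurable_funeneg|exact: measurable_funepos].
congr (_ - _); apply: eq_integral => x _.
  by rewrite !funeposE/= EFinM maxe_pMl ?lee_fin// mul0e.
by rewrite !funenegE/= -mulNr EFinM maxe_pMl ?lee_fin// mul0e.
Qed.

End density.

Section truncation.
Context d (T : measurableType d) (R : realType) (mu : {measure set T -> \bar R}).

(** The functions f * 1_(E n) converge pointwise to f on D and are dominated by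
    the integrable function |f|. *)
Lemma cvg_Rintegral_truncation (D : set T) (E : (set T)^nat) (f : T -> R) :
  measurable D -> (forall n, measurable (E n)) -> (forall n, E n `<=` D) ->
  (forall x, D x -> \forall n \near \oo, E n x) ->
  mu.-integrable D (EFin \o f) ->
  \int[mu]_(x in E n) f x @[n --> \oo] --> \int[mu]_(x in D) f x.
Proof.
move=> mD mE ED DE fi.
have mf : measurable_fun D f by apply/measurable_EFinP; exact: measurable_int fi.
have [] := @dominated_convergence _ _ _ mu D mD
  (fun n x => (f x * \1_(E n) x)%:E) (fun x => (f x)%:E) (fun x => `|(f x)%:E|%E).
- move=> n; apply/measurable_EFinP/measurable_funM => //.
- exact/measurable_EFinP.
- apply: aeW => x Dx; apply: cvg_near_cst.
  by near=> n; rewrite indicE mem_set ?mulr1//; near: n; exact: DE.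
- exact: integrable_abse.
- apply: aeW => x n Dx; rewrite lee_fin normrM ler_piMr// indicE.
  by case: (_ \in _); rewrite ?normr1 ?normr0.
move=> _ _ cv.
have -> : (fun n => \int[mu]_(x in E n) f x)
    = fine \o (fun n => \int[mu]_(x in D) (f x * \1_(E n) x)%:E)%E.
  apply/funext => n /=; rewrite /Rintegral; congr fine.
  rewrite -[in LHS](setIidr (ED n)) integral_mkcondr.
  apply: eq_integral => x _; rewrite patchE indicE.
  by case: (_ \in _); rewrite ?mulr1 ?mulr0.
by apply: fine_cvg; rewrite fineK//; exact: integrable_fin_num.
Unshelve. all: end_near. Qed.

End truncation.

Section product.
Context d1 d2 (T1 : measurableType d1) (T2 : measurableType d2) (R : realType).
Variables (m1 : {sigma_finite_measure set T1 -> \bar R})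
  (m2 : {sigma_finite_measure set T2 -> \bar R}).
Variables (f : T1 -> R) (g : T2 -> R).
Hypothesis fi : m1.-integrable setT (EFin \o f).
Hypothesis gi : m2.-integrable setT (EFin \o g).

Lemma integrable_prod_measure :
  (m1 \x m2)%E.-integrable setT (fun p => (f p.1 * g p.2)%:E).
Proof.
have mf : measurable_fun setT f by apply/measurable_EFinP; exact: measurable_int fi.
have mg : measurable_fun setT g by apply/measurable_EFinP; exact: measurable_int gi.
apply/integrable12ltyP.
  by apply/measurable_EFinP/measurable_funM; exact: measurableT_comp.
have -> : (fun x => \int[m2]_y `|(f (x, y).1 * g (x, y).2)%:E|)%E
    = (fun x => (\int[m2]_y `|(g y)%:E|) * `|(f x)%:E|)%E.
  apply/funext => x /=; rewrite muleC -ge0_integralZl//.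
    by apply: eq_integral => y _; rewrite -EFinM normrM.
  by apply/measurable_EFinP; exact: measurableT_comp.
move/integrableP : fi => [_ lf]; move/integrableP : gi => [_ lg].
rewrite ge0_integralZl//; last 2 first.
- by apply/measurable_EFinP; exact: measurableT_comp.
- by apply: integral_ge0.
have gfin : (\int[m2]_y `|(g y)%:E|)%E \is a fin_num.
  by rewrite ge0_fin_numE ?integral_ge0.
rewrite -(fineK gfin).
have ffin : (\int[m1]_y `|(f y)%:E|)%E \is a fin_num.
  by rewrite ge0_fin_numE ?integral_ge0.
by rewrite -(fineK ffin) -EFinM ltry.
Qed.

Lemma Rintegral_prod_measure :
  \int[(m1 \x m2)%E]_p (f p.1 * g p.2) = \int[m1]_x f x * \int[m2]_y g y.
Proof.
rewrite {1}/Rintegral -(integral12_prod_meas1 integrable_prod_measure).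
have -> : fubini_F m2 (fun p : T1 * T2 => (f p.1 * g p.2)%:E)
    = (fun x => (f x * \int[m2]_y g y)%:E).
  apply/funext => x; rewrite /fubini_F/=.
  under eq_integral do rewrite EFinM.
  by rewrite integralZl// EFinM /Rintegral fineK// integrable_fin_num.
by rewrite -[LHS]/(\int[m1]_x (f x * \int[m2]_y g y)) RintegralZr.
Qed.

End product.

(** * Products of polynomials, Gaussians and cosines *)

Section gaussian_waves.
Context (R : realType).
Implicit Types (a c s t x : R) (n k : nat) (f g : R -> R).

(** Real parts of complex Gaussians times monomials.  The phase t is kept free so
    that sine waves are the waves of phase t - pi / 2, and so that
    differentiation stays within their span. *)
Definition gwave a c s t n x : R :=
  x ^+ n * expR (c * x - a * x ^+ 2) * cos (t + s * x).

Inductive gspan a : (R -> R) -> Prop :=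
| gspan_wave c s t n : gspan a (gwave a c s t n)
| gspan_add f g : gspan a f -> gspan a g -> gspan a (fun x => f x + g x)
| gspan_scale (r : R) f : gspan a f -> gspan a (fun x => r * f x).

Lemma is_derive_gwave a c s t n x :
  is_derive x 1 (gwave a c s t n)
    (n%:R * gwave a c s t n.-1 x + c * gwave a c s t n x
     + - (2 * a) * gwave a c s t n.+1 x + s * gwave a c s (t + pi / 2) n x).
Proof.
have dX : is_derive x 1 (fun y : R => y ^+ n) (n%:R * x ^+ n.-1).
  have := @is_deriveX R _ id n x 1 1 (is_derive_id x 1).
  rewrite /GRing.scale/= mulr1; congr is_derive.
  by apply/funext => y; rewrite exprfctE.
have dE : is_derive x 1 (fun y : R => expR (c * y - a * y ^+ 2))
    (expR (c * x - a * x ^+ 2) * (c - 2 * a * x)).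
  apply: (is_derive1_comp (f := expR)).
  have := is_deriveB (is_deriveZ c (is_derive_id x 1))
    (is_deriveZ a (is_deriveX 2 (is_derive_id x 1))).
  congr is_derive.
  by rewrite /GRing.scale/=; ring.
have dC : is_derive x 1 (fun y : R => cos (t + s * y)) (- sin (t + s * x) * s).
  apply: (is_derive1_comp (f := cos)).
  have := is_deriveD (is_derive_cst t x 1) (is_deriveZ s (is_derive_id x 1)).
  by congr is_derive; rewrite /GRing.scale/=; ring.
have := is_deriveM (is_deriveM dX dE) dC; congr is_derive.
rewrite /gwave; have -> : cos (t + pi / 2 + s * x) = - sin (t + s * x).
  by rewrite addrAC cosDpihalf.
rewrite !fctE /GRing.scale/= [in X in _ = X]exprS.
set E := expR _; set C := cos _; set S := sin _.
by case: n dX => [|n] _; rewrite /= ?expr0 ?exprS; ring.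
Qed.

Lemma is_derive_gspan a f : gspan a f ->
  exists2 g, gspan a g & forall x, is_derive x 1 f (g x).
Proof.
elim=> [c s t n|u v _ [u' su' du] _ [v' sv' dv]|r u _ [u' su' du]].
- exists (fun x => n%:R * gwave a c s t n.-1 x + c * gwave a c s t n x
     + - (2 * a) * gwave a c s t n.+1 x + s * gwave a c s (t + pi / 2) n x).
    apply: (@gspan_add a (fun x => n%:R * gwave a c s t n.-1 x
      + c * gwave a c s t n x + - (2 * a) * gwave a c s t n.+1 x)); last first.
      by apply: gspan_scale; exact: gspan_wave.
    apply: (@gspan_add a (fun x => n%:R * gwave a c s t n.-1 x
      + c * gwave a c s t n x)).
      by apply: gspan_add; apply: gspan_scale; exact: gspan_wave.
    by apply: gspan_scale; exact: gspan_wave.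
  exact: is_derive_gwave.
- exists (fun x => u' x + v' x); first exact: gspan_add.
  by move=> x; exact: is_deriveD.
- exists (fun x => r * u' x); first exact: gspan_scale.
  by move=> x; exact: is_deriveZ.
Qed.

Lemma expr_le_fact_expR k x : 0 <= x -> x ^+ k <= k`!%:R * expR x.
Proof.
case: k => [|k] x0.
  by rewrite expr0 fact0 mul1r -expR0 ler_expR.
rewrite -ler_pdivrMl ?ltr0n ?fact_gt0// mulrC.
by apply: le_trans (expR_ge1Dxn k x0); rewrite lerDr.
Qed.

(** Completing the square gives c x - a x ^ 2 + |x| <= (|c| + 1) ^ 2 / (4 a), and
    a power of |x| is at most a multiple of exp |x|.  This decay drives
    integrability, the vanishing at infinity and the Schwartz property. *)
Lemma gspan_bounded a f k : 0 < a -> gspan a f ->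
  exists M : R, forall x, `|x| ^+ k * `|f x| <= M.
Proof.
move=> a0; elim=> [c s t n|u v _ [M1 M1P] _ [M2 M2P]|r u _ [M MP]].
- exists ((k + n)`!%:R * expR ((`|c| + 1) ^+ 2 / (4 * a))) => x.
  rewrite /gwave !normrM normrX mulrA mulrA -exprD.
  apply: (@le_trans _ _ (`|x| ^+ (k + n) * `|expR (c * x - a * x ^+ 2)|)).
    by apply: ler_piMr; rewrite ?mulr_ge0 ?exprn_ge0// ler_norml ?cos_geN1 ?cos_le1.
  rewrite [`|expR _|]ger0_norm ?expR_ge0//.
  have xk := @expr_le_fact_expR (k + n) `|x| (normr_ge0 x).
  apply: (le_trans (ler_wpM2r (expR_ge0 _) xk)).
  rewrite -mulrA ler_pM2l ?ltr0n ?fact_gt0// -expRD ler_expR.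
  have cx : c * x <= `|c| * `|x| by rewrite -normrM ler_norm.
  rewrite ler_pdivlMr ?mulr_gt0// -[x ^+ 2]real_normK ?num_real//.
  apply: (@le_trans _ _ ((`|x| + (`|c| * `|x| - a * `|x| ^+ 2)) * (4 * a))).
    by rewrite ler_pM2r ?mulr_gt0// lerD2l lerD2r.
  rewrite -subr_ge0 (_ : _ - _ = ((`|c| + 1) - 2 * a * `|x|) ^+ 2) ?sqr_ge0//.
  by ring.
- exists (M1 + M2) => x; apply: le_trans (lerD (M1P x) (M2P x)).
  by rewrite -mulrDr ler_wpM2l ?exprn_ge0// ler_normD.
- exists (`|r| * M) => x; rewrite normrM mulrCA.
  by rewrite ler_wpM2l.
Qed.

Lemma continuous_gspan a f : gspan a f -> continuous f.
Proof.
move=> /is_derive_gspan[g _ fg] x; apply/differentiable_continuous.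
by apply/derivable1_diffP; have [] := fg x.
Qed.

Lemma measurable_gspan a f : gspan a f -> measurable_fun setT f.
Proof. by move=> /continuous_gspan; exact: continuous_measurable_fun. Qed.


End gaussian_waves.

(** * Integration of Gaussian waves *)

Section gaussian_integrals.
Context (R : realType).
Implicit Types (a c s t x : R) (n k : nat) (f g : R -> R).
Local Notation leb := (@lebesgue_measure R).

Lemma gaussian_peak a m : 0 < a -> forall x,
  expR (- (a * (x - m) ^+ 2)) = Num.sqrt (pi / a) * normal_pdf m (Num.sqrt (2 * a)^-1) x.
Proof.
move=> a0 x.
have a20 : 0 < (2 * a)^-1 :> R by rewrite invr_gt0 mulr_gt0.
have a' : a != 0 by rewrite gt_eqF.
rewrite normal_pdfE ?gt_eqF ?sqrtr_gt0// /normal_peak /normal_fun.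
rewrite sqr_sqrtr ?ltW//.
rewrite (_ : (2 * a)^-1 * pi *+ 2 = pi / a); last by field.
rewrite mulVKf; last by rewrite gt_eqF// sqrtr_gt0 divr_gt0// pi_gt0.
by congr expR; field.
Qed.

Lemma integrable_gaussian a m : 0 < a ->
  leb.-integrable setT (EFin \o (fun x => expR (- (a * (x - m) ^+ 2)))).
Proof.
move=> a0; rewrite (_ : _ \o _ = fun x => ((Num.sqrt (pi / a))%:E * (normal_pdf m (Num.sqrt (2 * a)^-1) x)%:E)%E).
  by apply: integrableZl => //; exact: integrable_normal_pdf.
by apply/funext => x /=; rewrite gaussian_peak// EFinM.
Qed.

Lemma Rintegral_gaussian a m : 0 < a ->
  \int[leb]_x expR (- (a * (x - m) ^+ 2)) = Num.sqrt (pi / a).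
Proof.
move=> a0; under eq_Rintegral do rewrite gaussian_peak//.
rewrite RintegralZl//; last exact: integrable_normal_pdf.
by rewrite /Rintegral integral_normal_pdf mulr1.
Qed.

Lemma cvgnS : (n.+1%:R : R) @[n --> \oo] --> +oo.
Proof. by rewrite -[X in X --> _]/([sequence (n%:R : R)]_n n.+1 @[n --> \oo]) cvg_shiftS; exact: cvgr_idn. Qed.

(** Half of the Gaussian factor is spent on bounding the wave, and the other half
    is integrable. *)
Lemma integrable_gspan a f : 0 < a -> gspan a f ->
  leb.-integrable setT (EFin \o f).
Proof.
move=> a0; elim=> [c s t n|u v _ ui _ vi|r u _ ui].
- have [M MP] := @gspan_bounded R (a / 2) _ 0 (divr_gt0 a0 (ltr0n _ 2)) (gspan_wave (a / 2) c s t n).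
  have ig : leb.-integrable setT (fun x => (M%:E * (expR (- (a / 2 * (x - 0) ^+ 2)))%:E)%E).
    by apply: integrableZl => //; apply: integrable_gaussian; rewrite divr_gt0.
  apply: (le_integrable _ _ _ ig) => //.
    apply/measurable_EFinP; exact: measurable_gspan (gspan_wave a c s t n).
  move=> x _; rewrite -EFinM lee_fin/= [leRHS]ger0_norm; last first.
    rewrite mulr_ge0 ?expR_ge0//.
    by apply: le_trans (MP 0); rewrite mulr_ge0// exprn_ge0.
  rewrite (_ : gwave _ _ _ _ _ _ = gwave (a / 2) c s t n x * expR (- (a / 2 * (x - 0) ^+ 2))).
    rewrite normrM [X in _ * X]ger0_norm ?expR_ge0// ler_wpM2r ?expR_ge0//.
    by have := MP x; rewrite expr0 mul1r.
  rewrite /gwave (_ : c * x - a * x ^+ 2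
    = c * x - a / 2 * x ^+ 2 + - (a / 2 * (x - 0) ^+ 2)); last by field.
  by rewrite expRD; ring.
- rewrite (_ : _ \o _ = (EFin \o u) \+ (EFin \o v))%E; last by apply/funext.
  exact: integrableD.
- rewrite (_ : _ \o _ = (fun x => r%:E * (EFin \o u) x)%E); last by apply/funext.
  exact: integrableZl.
Qed.

Lemma cvg_gspan0 a f (u : R^nat) : 0 < a -> gspan a f ->
  (`|u n| @[n --> \oo] --> +oo) -> f (u n) @[n --> \oo] --> 0.
Proof.
move=> a0 sf ucv; have [M MP] := @gspan_bounded R a f 1 a0 sf.
have M0 : 0 <= M by apply: le_trans (MP 0); rewrite mulr_ge0// exprn_ge0.
apply/cvgr0Pnorm_lt => e e0.
have : \forall n \near \oo, M / e < `|u n| by move/cvgryPgt : ucv; apply.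
apply: filterS => n un.
have un0 : 0 < `|u n| by apply: le_lt_trans un; rewrite divr_ge0// ltW.
move: un; rewrite ltr_pdivrMr// => un.
have := le_lt_trans (MP (u n)) un; rewrite expr1 ltr_pM2l//.
Qed.

Lemma FTC_gspan a f g (p q : R) : p < q -> gspan a f -> gspan a g ->
  (forall x, is_derive x 1 f (g x)) ->
  \int[leb]_(x in `[p, q]) g x = f q - f p.
Proof.
move=> pq sf sg fg; rewrite /Rintegral (@continuous_FTC2 _ g f)//.
- exact/continuous_subspaceT/continuous_gspan/sg.
- split.
  + by move=> x _; have [] := fg x.
  + by apply: cvg_at_right_filter; exact: (continuous_gspan sf).
  + by apply: cvg_at_left_filter; exact: (continuous_gspan sf).
- by move=> x _; rewrite derive1E; have [_ ->] := fg x.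
Qed.

(** Integration by parts over the line without boundary terms; all moment and
    differential identities below are instances of it. *)
Lemma Rintegral_derive_gspanT a f g : 0 < a -> gspan a f -> gspan a g ->
  (forall x, is_derive x 1 f (g x)) -> \int[leb]_x g x = 0.
Proof.
move=> a0 sf sg fg.
pose E (n : nat) : set R := `[- n.+1%:R, n.+1%:R]%classic.
have lim1 : \int[leb]_(x in E n) g x @[n --> \oo] --> \int[leb]_x g x.
  apply: cvg_Rintegral_truncation => //.
  - by move=> n; exact: measurable_itv.
  - move=> x _; near=> n; rewrite /E/= in_itv/= -ler_norml.
    rewrite ltW// (@lt_trans _ _ n%:R) ?ltr_nat//.
    by near: n; exact: nbhs_infty_gtr.
  - exact: integrable_gspan sg.
have lim2 : \int[leb]_(x in E n) g x @[n --> \oo] --> 0.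
  rewrite (_ : (fun n => _) = (fun n => f n.+1%:R - f (- n.+1%:R))); last first.
    apply/funext => n; apply: (FTC_gspan _ sf sg fg).
    by rewrite gtrN.
  rewrite -[X in _ --> X](subrr 0); apply: cvgB.
    by apply: (cvg_gspan0 a0 sf); under eq_fun do rewrite ger0_norm//; exact: cvgnS.
  by apply: (cvg_gspan0 a0 sf); under eq_fun do rewrite normrN ger0_norm//; exact: cvgnS.
exact: cvg_unique lim1 lim2.
Unshelve. all: end_near. Qed.

End gaussian_integrals.

(** * The Fourier transform of a Gaussian *)

Section gaussian_fourier.
Context (R : realType).
Implicit Types (a c s t x : R) (n k : nat) (f g : R -> R).
Local Notation leb := (@lebesgue_measure R).

Lemma Rintegral_derive_gspan_half a f g : 0 < a -> gspan a f -> gspan a g ->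
  (forall x, is_derive x 1 f (g x)) -> \int[leb]_(x in `[0, +oo[) g x = - f 0.
Proof.
move=> a0 sf sg fg.
pose E (n : nat) : set R := `[0, n.+1%:R]%classic.
have lim1 : \int[leb]_(x in E n) g x @[n --> \oo] --> \int[leb]_(x in `[0, +oo[) g x.
  apply: cvg_Rintegral_truncation => //.
  - by move=> n; exact: measurable_itv.
  - by move=> n x; rewrite /E/= !in_itv/= => /andP[->].
  - move=> x/=; rewrite in_itv/= andbT => x0; near=> n; rewrite /E/= in_itv/= x0/=.
    rewrite ltW// (@lt_trans _ _ n%:R) ?ltr_nat//.
    by near: n; exact: nbhs_infty_gtr.
  - by apply: integrableS (integrable_gspan a0 sg) => //; exact: measurable_itv.
have lim2 : \int[leb]_(x in E n) g x @[n --> \oo] --> - f 0.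
  rewrite (_ : (fun n => _) = (fun n => f n.+1%:R - f 0)); last first.
    by apply/funext => n; apply: (FTC_gspan _ sf sg fg).
  rewrite -[X in _ --> X]add0r; apply: cvgB; last exact: cvg_cst.
  by apply: (cvg_gspan0 a0 sf); under eq_fun do rewrite ger0_norm//; exact: cvgnS.
exact: cvg_unique lim1 lim2.
Unshelve. all: end_near. Qed.

Lemma gwave_phaseDpi a c s t n x :
  gwave a c s (t + pi / 2) n x = - gwave a c s (t - pi / 2) n x.
Proof.
by rewrite /gwave addrAC cosDpihalf [X in - (_ * cos X)]addrAC cosBpihalf mulrN.
Qed.

Lemma Rintegral_gwave0 a c t : 0 < a ->
  \int[leb]_x gwave a c 0 t 0 x = Num.sqrt (pi / a) * expR (c ^+ 2 / (4 * a)) * cos t.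
Proof.
move=> a0; have a' : a != 0 by rewrite gt_eqF.
have E x : gwave a c 0 t 0 x
    = expR (c ^+ 2 / (4 * a)) * cos t * expR (- (a * (x - c / (2 * a)) ^+ 2)).
  rewrite /gwave mul0r addr0 expr0 mul1r mulrAC -expRD; congr (expR _ * _).
  by field.
under eq_Rintegral do rewrite E.
by rewrite RintegralZl ?Rintegral_gaussian//; [ring|exact: integrable_gaussian].
Qed.

Section ode.
Variables (a c t : R).
Hypothesis a0 : 0 < a.
Let m := c / (2 * a).
Let phi s x := gwave a c s (t - s * m) 0 x.
Let dphi s x := gwave a c s (t - s * m + pi / 2) 1 x
  - m * gwave a c s (t - s * m + pi / 2) 0 x.
Let Phi s := \int[leb]_x phi s x.

Let is_derive_phi s x : is_derive s 1 (phi ^~ x) (dphi s x).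
Proof.
have dC : is_derive s 1 (fun s : R => cos (t - s * m + s * x))
    (- sin (t - s * m + s * x) * (x - m)).
  apply: (is_derive1_comp (f := cos) (g := fun s => t - s * m + s * x)).
  rewrite (_ : (fun s => _) = (cst t + (x - m) \*: id)); last first.
    by apply/funext => y; rewrite !fctE/= /GRing.scale/=; ring.
  have := is_deriveD (is_derive_cst t s 1) (is_deriveZ (x - m) (is_derive_id s 1)).
  by congr is_derive; rewrite /GRing.scale/= add0r mulr1.
have := is_deriveZ (expR (c * x - a * x ^+ 2)) dC.
rewrite (_ : _ \*: _ = phi ^~ x); last first.
  by apply/funext => y; rewrite /phi /gwave expr0 mul1r.
congr is_derive; rewrite /dphi /gwave ![t - _ + pi / 2 + _]addrAC !cosDpihalf.
by rewrite /GRing.scale/=; ring.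
Qed.

Let integrable_phi s : leb.-integrable setT (EFin \o phi s).
Proof. by apply: (integrable_gspan a0); exact: gspan_wave. Qed.

Let der_Phi s : is_derive s 1 Phi (\int[leb]_x dphi s x).
Proof.
pose G x := `|gwave a c 0 0 1 x - m * gwave a c 0 0 0 x|.
have sG : gspan a (fun x => gwave a c 0 0 1 x + - m * gwave a c 0 0 0 x).
  by apply: gspan_add; [exact: gspan_wave|apply: gspan_scale; exact: gspan_wave].
have iG : leb.-integrable setT (EFin \o G).
  rewrite (_ : _ \o _ = (fun x => `|(gwave a c 0 0 1 x + - m * gwave a c 0 0 0 x)%:E|%E)).
    by apply: integrable_abse; exact: (integrable_gspan a0).
  by apply/funext => x; rewrite /G/= mulNr.
have ss : `](s - 1), (s + 1)[%classic s.
  by rewrite /= in_itv/=; apply/andP; split; lra.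
have dE y x : partial1of2 phi y x = dphi y x.
  by rewrite partial1of2E; have [_ ->] := is_derive_phi y x.
(* |cos| <= 1 gives a bound by a Gaussian wave that does not depend on s. *)
have Gub y x : `](s - 1), (s + 1)[%classic y -> setT x -> `|partial1of2 phi y x| <= G x.
  move=> _ _; rewrite dE /dphi /G /gwave !mul0r !addr0 cos0 expr0 expr1 !mul1r !mulr1.
  rewrite mulrA -!mulrBl normrM mulrA -mulrBl; apply: ler_piMr => //.
  by rewrite ler_norml ?cos_geN1 ?cos_le1.
have dd y x : `](s - 1), (s + 1)[%classic y -> setT x -> derivable (phi ^~ x) y 1.
  by move=> _ _; have [] := is_derive_phi y x.
apply: DeriveDef.
  exact: (@derivable_under_integral _ _ _ leb phi setT measurableT s (s - 1) (s + 1) ss (fun y _ => integrable_phi y) dd G (fun _ => normr_ge0 _) iG Gub).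
rewrite -derive1E (@differentiation_under_integral _ _ _ leb phi setT measurableT s (s - 1) (s + 1) ss (fun y _ => integrable_phi y) dd G (fun _ => normr_ge0 _) iG Gub).
by apply: eq_Rintegral => x _; exact: dE.
Qed.

Let ode_Phi s : \int[leb]_x dphi s x = - (s / (2 * a)) * Phi s.
Proof.
have a' : a != 0 by rewrite gt_eqF.
have i n t' : leb.-integrable setT (EFin \o gwave a c s t' n).
  by apply: (integrable_gspan a0); exact: gspan_wave.
have sF := gspan_wave a c s (t - s * m - pi / 2) 0.
have sF' : gspan a (fun x => c * gwave a c s (t - s * m - pi / 2) 0 x
    + (- (2 * a) * gwave a c s (t - s * m - pi / 2) 1 x + s * phi s x)).
  apply: gspan_add; first by apply: gspan_scale; exact: gspan_wave.
  by apply: gspan_add; apply: gspan_scale; exact: gspan_wave.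
have := Rintegral_derive_gspanT a0 sF sF'.
move=> /(_ _)/wrap[] => [x|].
  have := is_derive_gwave a c s (t - s * m - pi / 2) 0 x.
  by congr is_derive; rewrite /phi subrK; ring.
have iZ n t' (r : R) : leb.-integrable setT (EFin \o (fun x => r * gwave a c s t' n x)).
  by apply: (integrable_gspan a0); apply: gspan_scale; exact: gspan_wave.
rewrite RintegralD//; last first.
  apply: (integrable_gspan a0).
  by apply: gspan_add; apply: gspan_scale; exact: gspan_wave.
rewrite RintegralD//; last exact: iZ.
rewrite !RintegralZl//.
rewrite -/(Phi s) => H.
rewrite /dphi RintegralB//.
rewrite RintegralZl//.
under eq_Rintegral do rewrite gwave_phaseDpi -mulN1r.
under [in X in _ - X]eq_Rintegral do rewrite gwave_phaseDpi -mulN1r.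
rewrite !RintegralZl//.
apply: (@mulfI _ (2 * a)); first by rewrite mulf_neq0.
rewrite /m; apply/eqP; rewrite -subr_eq0 -[X in _ == X]H; apply/eqP.
by field.
Qed.

(** Differentiating under the integral sign and integrating by parts shows that
    Phi satisfies Phi' = - (s / (2 a)) Phi.  Centring the phase at the mean
    m = c / (2 a) of the Gaussian factor is what decouples this equation from
    the one for the sine wave. *)
Lemma Rintegral_gwave_centered s : Phi s
  = Num.sqrt (pi / a) * expR ((c ^+ 2 - s ^+ 2) / (4 * a)) * cos t.
Proof.
have a' : a != 0 by rewrite gt_eqF.
(* The integrating factor of the equation for Phi. *)
pose E := fun s : R => expR (s ^+ 2 / (4 * a)).
have dE (y : R) : is_derive y 1 E (expR (y ^+ 2 / (4 * a)) * (y / (2 * a))).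
  apply: (is_derive1_comp (f := expR) (g := fun s => s ^+ 2 / (4 * a))).
  have := is_deriveZ ((4 * a)^-1) (is_deriveX 2 (is_derive_id y 1)).
  rewrite (_ : _ \*: _ = fun s => s ^+ 2 / (4 * a)); last first.
    by apply/funext => z; rewrite /= /GRing.scale/= mulrC.
  by congr is_derive; rewrite /GRing.scale/=; field.
have d0 (y : R) : is_derive y 1 (E * Phi) 0.
  have := is_deriveM (dE y) (der_Phi y).
  by congr is_derive; rewrite ode_Phi /GRing.scale/= /E; ring.
have := is_derive_0_is_cst s 0 d0.
rewrite !fctE /E expr0n/= mul0r expR0 mul1r.
rewrite /Phi /phi mul0r subr0 Rintegral_gwave0// => H.
rewrite -[LHS](mulKf (lt0r_neq0 (expR_gt0 (s ^+ 2 / (4 * a))))) H.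
by rewrite -expRN mulrBl expRD; ring.
Qed.

End ode.

(** The Fourier transform of a shifted Gaussian, in real form. *)
Lemma Rintegral_gwave a c s t : 0 < a -> \int[leb]_x gwave a c s t 0 x
  = Num.sqrt (pi / a) * expR ((c ^+ 2 - s ^+ 2) / (4 * a)) * cos (t + s * c / (2 * a)).
Proof.
move=> a0; rewrite -Rintegral_gwave_centered//.
by apply: eq_Rintegral => x _; rewrite mulrA addrK.
Qed.

End gaussian_fourier.

(** * Gaussian waves over half-lines *)

Section quarter_plane.
Context (R : realType).
Implicit Types (a c s t x : R) (n k : nat) (f g : R -> R).
Local Notation leb := (@lebesgue_measure R).

(** The expectation of 1_D x * exp (c x) * cos (t + s x) when x is a centred
    Gaussian variable of variance 1 / (2 a). *)
Definition gint a (D : set R) c s t : R :=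
  (Num.sqrt (pi / a))^-1 * \int[leb]_(x in D) gwave a c s t 0 x.

(** Written with an extended bound, as in the symbol, so that b = +oo gives the whole
    half-line. *)
Definition ray (b : \bar R) : set R := [set t | 0 <= t /\ (t%:E < b)%E].

Lemma measurable_ray b : measurable (ray b).
Proof.
case: b => [b| |].
- rewrite (_ : ray _ = `[0, b[%classic); first exact: measurable_itv.
  by apply/seteqP; split => x; rewrite /ray/= in_itv/= lte_fin => /andP.
- rewrite (_ : ray _ = `[0, +oo[%classic); first exact: measurable_itv.
  by apply/seteqP; split => x; rewrite /ray/= in_itv/= andbT ltry => // -[].
- rewrite (_ : ray _ = set0); first exact: measurable0.
  by apply/seteqP; split => x // -[].
Qed.

Lemma cvg_gint_ray a c s t (b : (\bar R)^nat) : 0 < a ->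
  (forall n, (n%:R%:E <= b n)%E) ->
  gint a (ray (b n)) c s t @[n --> \oo] --> gint a (ray +oo%E) c s t.
Proof.
move=> a0 nb; apply: cvgM; first exact: cvg_cst.
apply: cvg_Rintegral_truncation.
- exact: measurable_ray.
- by move=> n; exact: measurable_ray.
- by move=> n x [x0 _]; split => //; rewrite ltry.
- move=> x [x0 _]; near=> n; split => //; apply: lt_le_trans (nb n).
  by rewrite lte_fin; near: n; exact: nbhs_infty_gtr.
- apply: (@integrableS _ _ _ leb setT) => //; first exact: measurable_ray.
  exact: (integrable_gspan a0 (gspan_wave _ _ _ _ _)).
Unshelve. all: end_near. Qed.

Lemma gintT a c s t : 0 < a -> gint a setT c s t
  = expR ((c ^+ 2 - s ^+ 2) / (4 * a)) * cos (t + s * c / (2 * a)).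
Proof.
move=> a0; rewrite /gint Rintegral_gwave// -!mulrA mulKf//.
by rewrite gt_eqF// sqrtr_gt0 divr_gt0// pi_gt0.
Qed.

Section half_line.
Variable a : R.
Hypothesis a0 : 0 < a.
Let Z := Num.sqrt (pi / a).
Let Z0 : 0 < Z. Proof. by rewrite sqrtr_gt0 divr_gt0// pi_gt0. Qed.

(** The left half-line contributes at most 1, because exp (c x) <= 1 there. *)
Lemma gint_exp_half c : 0 <= c -> expR (c ^+ 2 / (4 * a)) - 1 <= gint a (ray +oo%E) c 0 0.
Proof.
move=> c0.
have I c' : leb.-integrable setT (EFin \o gwave a c' 0 0 0).
  exact: (integrable_gspan a0 (gspan_wave _ _ _ _ _)).
have mD := measurable_ray +oo%E; have mC := measurableC mD.
have : gint a setT c 0 0 = gint a (ray +oo%E) c 0 0 + gint a (~` ray +oo%E) c 0 0.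
  rewrite /gint -mulrDr -(setUv (ray +oo%E)) Rintegral_setU ?setUv//.
  exact/disj_setPCl.
rewrite gintT// !mul0r addr0 cos0 mulr1 expr0n/= subr0 => ->.
rewrite lerBlDr lerD2l /gint.
rewrite -ler_pdivlMl ?invr_gt0// invrK mulr1.
have -> : Num.sqrt (pi / a) = \int[leb]_x gwave a 0 0 0 0 x.
  by rewrite Rintegral_gwave// !(expr0n,mul0r,addr0)/= subr0 mul0r expR0 cos0 !mulr1.
apply: (@le_trans _ _ (\int[leb]_(x in ~` ray +oo%E) gwave a 0 0 0 0 x)).
  apply: le_Rintegral => //.
  - exact: integrableS (I c).
  - exact: integrableS (I 0).
  - move=> x; rewrite /ray/= => /not_andP[|]; last by rewrite ltry.
    move=> /negP; rewrite -ltNge => x0.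
    rewrite /gwave !mul0r addr0 cos0 !mulr1 !mul1r ler_expR lerD2r.
    by rewrite mulr_ge0_le0// ltW.
rewrite -[leRHS](_ : \int[leb]_(x in ray +oo%E `|` ~` ray +oo%E) gwave a 0 0 0 0 x = _); last by rewrite setUv.
rewrite Rintegral_setU ?setUv//; last exact/disj_setPCl.
rewrite lerDr; apply: Rintegral_ge0 => x _.
by rewrite /gwave !mul0r addr0 cos0 mulr1 expr0 mul1r expR_ge0.
Qed.

(** A sharp edge makes the sine transform decay only like 1 / k, although the full
    Fourier transform is exponentially small.  With e = exp (- a x ^ 2), the function
    F = - cos (k x) e / k - (2 a / k ^ 2) x sin (k x) e has the derivative
    sin (k x) e (1 - (2 a / k ^ 2) (1 - 2 a x ^ 2)), so the main term - F 0 = 1 / k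
    is exact and the rest is bounded by a second moment. *)
Lemma gint_sin_half (k : R) : 0 < k ->
  Z^-1 / k - 4 * a / k ^+ 2 <= gint a (ray +oo%E) 0 k (- (pi / 2)).
Proof.
move=> k0; have k' : k != 0 by rewrite gt_eqF.
have a' : a != 0 by rewrite gt_eqF.
pose F x := - k^-1 * gwave a 0 k 0 0 x + - (2 * a / k ^+ 2) * gwave a 0 k (- (pi / 2)) 1 x.
pose h x := 2 * a / k ^+ 2 * gwave a 0 k (- (pi / 2)) 0 x
   + - (4 * a ^+ 2 / k ^+ 2) * gwave a 0 k (- (pi / 2)) 2 x.
pose F' x := gwave a 0 k (- (pi / 2)) 0 x + - 1 * h x.
have sF : gspan a F by apply: gspan_add; apply: gspan_scale; exact: gspan_wave.
have sh : gspan a h by apply: gspan_add; apply: gspan_scale; exact: gspan_wave.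
have sF' : gspan a F'.
  by apply: gspan_add; [exact: gspan_wave|exact: gspan_scale].
have dF x : is_derive x 1 F (F' x).
  have := is_deriveD (is_deriveZ (- k^-1) (is_derive_gwave a 0 k 0 0 x))
    (is_deriveZ (- (2 * a / k ^+ 2)) (is_derive_gwave a 0 k (- (pi / 2)) 1 x)).
  congr is_derive; rewrite /F' /h /GRing.scale/= gwave_phaseDpi sub0r addNr.
  by field.
have E : [set` `[(0:R), +oo[] = ray +oo%E.
  by apply/seteqP; split => x; rewrite /ray/= in_itv/= andbT ltry => // -[].
have mD := measurable_ray +oo%E; have mC := measurableC mD.
have iT f : gspan a f -> leb.-integrable setT (EFin \o f).
  by move=> /(integrable_gspan a0).
have i f : gspan a f -> leb.-integrable (ray +oo%E) (EFin \o f).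
  by move=> /iT; exact: integrableS.
pose H x := 2 * a / k ^+ 2 * gwave a 0 0 0 0 x + 4 * a ^+ 2 / k ^+ 2 * gwave a 0 0 0 2 x.
have sH : gspan a H by apply: gspan_add; apply: gspan_scale; exact: gspan_wave.
have ac1 : 0 <= 2 * a / k ^+ 2 by rewrite divr_ge0 ?sqr_ge0// mulr_ge0// ltW.
have ac2 : 0 <= 4 * a ^+ 2 / k ^+ 2 by rewrite divr_ge0 ?sqr_ge0// mulr_ge0// sqr_ge0.
have H0 x : 0 <= H x.
  rewrite /H /gwave !mul0r !addr0 cos0 !mulr1 expr0 mul1r.
  apply: addr_ge0; apply: mulr_ge0 => //.
  by rewrite mulr_ge0 ?sqr_ge0 ?expR_ge0.
(* The second moment, from the derivative of x * exp (- a x ^ 2). *)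
have moment : \int[leb]_x gwave a 0 0 0 2 x = Z / (2 * a).
  have sI : gspan a (fun x => gwave a 0 0 0 0 x + - (2 * a) * gwave a 0 0 0 2 x).
    by apply: gspan_add; [exact: gspan_wave|apply: gspan_scale; exact: gspan_wave].
  have := Rintegral_derive_gspanT a0 (gspan_wave a 0 0 0 1) sI.
  move=> /(_ _)/wrap[] => [x|].
    by have := is_derive_gwave a 0 0 0 1 x; congr is_derive; rewrite /=; ring.
  rewrite RintegralD ?RintegralZl//; first last.
  - by apply: iT; apply: gspan_scale; exact: gspan_wave.
  - by apply: iT; exact: gspan_wave.
  - by apply: iT; exact: gspan_wave.
  rewrite Rintegral_gwave// !(expr0n,mul0r,addr0)/= subr0 mul0r expR0 cos0 !mulr1 -/Z.
  move=> /eqP; rewrite addr_eq0 mulNr opprK => /eqP ->.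
  by rewrite mulrC mulKf// mulf_neq0.
have intH : \int[leb]_x H x = 4 * a / k ^+ 2 * Z.
  rewrite RintegralD ?RintegralZl//; try (apply: iT; try apply: gspan_scale; exact: gspan_wave).
  rewrite moment Rintegral_gwave// !(expr0n,mul0r,addr0)/= subr0 mul0r expR0 cos0 !mulr1 -/Z.
  by field; rewrite k' a'.
have := Rintegral_derive_gspan_half a0 sF sF' dF.
rewrite E /F' RintegralD ?RintegralZl//; first last.
- by apply: i; exact: gspan_scale.
- by apply: i; exact: gspan_wave.
- exact: i.
have E0 : gwave a 0 k 0 0 0 = 1.
  by rewrite /gwave expr0 expr0n/= !mulr0 subrr addr0 expR0 cos0 !mulr1.
have E1 : gwave a 0 k (- (pi / 2)) 1 0 = 0 by rewrite /gwave expr1 !mul0r.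
rewrite /F E0 E1 mulr0 addr0 mulr1 opprK.
rewrite mulN1r => /eqP; rewrite subr_eq => /eqP intsin.
have leh : - (\int[leb]_(x in ray +oo%E) h x) <= 4 * a / k ^+ 2 * Z.
  rewrite -intH -mulN1r -RintegralZl//; last exact: i.
  apply: (@le_trans _ _ (\int[leb]_(x in ray +oo%E) H x)).
    apply: le_Rintegral => //; [|exact: i|].
      exact: (i _ (gspan_scale (-1) sh)).
    move=> x _; rewrite mulN1r /h /H /gwave !mul0r !addr0 cos0 !mulr1 !expr0 !mul1r opprD.
    have c1 : `|cos (- (pi / 2) + k * x)| <= 1 by rewrite ler_norml cos_geN1 cos_le1.
    have [c2 c3] : -1 <= cos (- (pi / 2) + k * x) /\ cos (- (pi / 2) + k * x) <= 1.
      by rewrite cos_geN1 cos_le1.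
    apply: lerD.
      rewrite -mulrN; apply: ler_wpM2l => //.
      by rewrite -mulrN; apply: ler_piMr; rewrite ?expR_ge0// lerNl.
    rewrite -mulNr opprK; apply: ler_wpM2l => //.
    by apply: ler_piMr; rewrite // mulr_ge0 ?expR_ge0 ?sqr_ge0.
  rewrite -[leRHS](_ : \int[leb]_(x in ray +oo%E `|` ~` ray +oo%E) H x = _); last by rewrite setUv.
  rewrite Rintegral_setU ?setUv//; [|exact: iT|exact/disj_setPCl].
  by rewrite lerDl; exact: Rintegral_ge0.
rewrite /gint -/Z intsin mulrDr lerD2l -lerN2 opprK -mulrN.
rewrite -ler_pdivlMl ?invr_gt0// invrK mulrC.
by apply: le_trans leh _; rewrite mulrC.
Qed.

End half_line.
End quarter_plane.

(** * The excess of the two-packet state over its norm *)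

Section excess.
Context (R : realType).
Variable a : R.
Hypothesis a0 : 0 < a.

(** The common position and momentum of the first packet: with a = 1 / h it lies at
    distance L = 10 from each axis, in units of sqrt h. *)
Definition momentum : R := 10 * Num.sqrt a.
(** The relative amplitude del of the second packet.  The gain
    2 * del * S ^ 2 - del ^ 2 is positive for del < 2 * S ^ 2, and S is
    at least 3 / 200 by [gint_sin_lb]. *)
Definition mixing : R := 100^-1 ^+ 2.
(** The squared norm exp (L ^ 2) of each of the two exponentials. *)
Definition cnorm : R := expR 100.

(** The value of the quadratic form on the two-packet state: the two direct terms,
    then the cross term, whose phase cos (2 kap (z - zeta)) has been split into
    products. *)
Definition quarter_form (b1 b2 : \bar R) : R :=
  cnorm^-1 * (gint a (ray b1) (2 * momentum) 0 0 * gint a (ray b2) (2 * momentum) 0 0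
    + mixing ^+ 2 * (gint a (ray b1) (- (2 * momentum)) 0 0 * gint a (ray b2) (- (2 * momentum)) 0 0))
  + 2 * mixing * cnorm *
    (gint a (ray b1) 0 (2 * momentum) 0 * gint a (ray b2) 0 (2 * momentum) 0
     + gint a (ray b1) 0 (2 * momentum) (- (pi / 2)) * gint a (ray b2) 0 (2 * momentum) (- (pi / 2))).

(** The squared norm of the two-packet state; the overlap of the packets accounts for
    the last term. *)
Definition state_norm2 : R := cnorm * (1 + mixing ^+ 2) + 2 * mixing * cnorm^-1.

Let sqr_momentum : momentum ^+ 2 = 100 * a.
Proof. by rewrite /momentum exprMn sqr_sqrtr ?ltW//; ring. Qed.

Lemma momentum_gt0 : 0 < momentum.
Proof. by rewrite mulr_gt0// sqrtr_gt0. Qed.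

Let cnorm_ge : 10 ^+ 8 <= cnorm.
Proof.
have := @expR_ge1Dxn R 100 5 (ler0n _ 100); apply: le_trans.
(* 100 ^ 6 / 6! is about 1.4 * 10 ^ 9; the term of degree 6 of the series is enough. *)
rewrite (_ : (6`!%:R : R) = 720) //; lra.
Qed.

Lemma mixing_gt0 : 0 < mixing.
Proof. by rewrite exprn_gt0// invr_gt0. Qed.

Lemma gint_sin_lb : 3 / 200 <= gint a (ray +oo%E) 0 (2 * momentum) (- (pi / 2)).
Proof.
have a' : a != 0 by rewrite gt_eqF.
apply: le_trans (gint_sin_half a0 _); last by rewrite mulr_gt0 ?momentum_gt0.
have -> : 4 * a / (2 * momentum) ^+ 2 = 100^-1.
  by rewrite exprMn sqr_momentum; field.
rewrite sqrtrM ?pi_ge0// sqrtrV ?(ltW a0)// /momentum.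
have sa : 0 < Num.sqrt a by rewrite sqrtr_gt0.
have sp : 0 < Num.sqrt (pi : R) by rewrite sqrtr_gt0 pi_gt0.
have sp2 : Num.sqrt pi <= 2 :> R.
  have <- : Num.sqrt ((2 : R) ^+ 2) = 2 by rewrite sqrtr_sqr ger0_norm.
  by rewrite ler_sqrt; have := @pihalf_lt2 R; lra.
have -> : (Num.sqrt pi / Num.sqrt a)^-1 / (2 * (10 * Num.sqrt a)) = 20^-1 * (Num.sqrt (pi : R))^-1.
  by field; rewrite !gt_eqF.
have : 2^-1 <= (Num.sqrt (pi : R))^-1 by rewrite lef_pV2 ?posrE.
set u := (Num.sqrt (pi : R))^-1; move: u => u hu.
lra.
Qed.

(** Dividing by cnorm, the first packet loses at most 2 / cnorm, the cross term gains
    2 * mixing * (3 / 200) ^ 2 and the second packet costs mixing ^ 2. *)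
Lemma quarter_form_limit_gt : state_norm2 < quarter_form +oo%E +oo%E.
Proof.
have P := gint_exp_half a0 (ltW (mulr_gt0 (ltr0n R 2) momentum_gt0)).
rewrite exprMn sqr_momentum in P.
have E : 2 ^+ 2 * (100 * a) / (4 * a) = 100 :> R by field; rewrite gt_eqF.
rewrite E -/cnorm in P; rewrite /state_norm2 /quarter_form.
move: P gint_sin_lb.
set p := gint a _ (2 * momentum) 0 0; set q := gint a _ (- _) 0 0.
set c := gint a _ 0 _ 0; set s := gint a _ 0 _ _ => P S.
have X := cnorm_ge; move: P X; set x := cnorm => P X.
have x0 : 0 < x by apply: lt_le_trans X.
have p2 : (x - 1) ^+ 2 <= p * p.
  rewrite -expr2 lerXn2r// nnegrE ?subr_ge0; lra.
have s2 : (3 / 200) ^+ 2 <= s * s.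
  rewrite -expr2 lerXn2r// nnegrE; lra.
have q2 : 0 <= q * q by rewrite -expr2 sqr_ge0.
have c2 : 0 <= c * c by rewrite -expr2 sqr_ge0.
have xi : x^-1 <= 1 by rewrite invf_le1//; lra.
have xi0 : 0 < x^-1 by rewrite invr_gt0.
have H1 : x - 2 <= x^-1 * (p * p + mixing ^+ 2 * (q * q)).
  apply: (@le_trans _ _ (x^-1 * (x - 1) ^+ 2)).
    rewrite mulrC ler_pdivlMr//; lra.
  apply: ler_wpM2l; first exact: ltW.
  apply: le_trans p2 _; rewrite lerDl; apply: mulr_ge0 => //; exact: sqr_ge0.
have H2 : 2 * mixing * x * (3 / 200) ^+ 2 <= 2 * mixing * x * (c * c + s * s).
  apply: ler_wpM2l; last by lra.
  by apply: mulr_ge0; [rewrite mulr_ge0// ltW// mixing_gt0|exact: ltW].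
apply: lt_le_trans (lerD H1 H2).
by move: x0 X xi; rewrite /mixing; clear; move=> *; lra.
Qed.

(** Otherwise there would be violating rectangles with sides tending to infinity, and
    their forms converge to the form of the quarter plane. *)
Lemma quarter_form_gt : exists2 A : R, 0 < A &
  forall b1 b2 : \bar R, (A%:E <= b1)%E -> (A%:E <= b2)%E -> state_norm2 < quarter_form b1 b2.
Proof.
apply: contrapT => H.
have {}H (n : nat) : exists b : \bar R * \bar R,
    [/\ (n%:R%:E <= b.1)%E, (n%:R%:E <= b.2)%E & quarter_form b.1 b.2 <= state_norm2].
  apply: contrapT => Hn; apply: H; exists n.+1%:R => // b1 b2 l1 l2.
  rewrite ltNge; apply/negP => l; apply: Hn; exists (b1, b2); split => //=.
  - by apply: le_trans l1; rewrite lee_fin ler_nat.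
  - by apply: le_trans l2; rewrite lee_fin ler_nat.
have [b /= bP] := choice H.
have cv1 c s t : gint a (ray (b n).1) c s t @[n --> \oo] --> gint a (ray +oo%E) c s t.
  by apply: cvg_gint_ray => // n; have [] := bP n.
have cv2 c s t : gint a (ray (b n).2) c s t @[n --> \oo] --> gint a (ray +oo%E) c s t.
  by apply: cvg_gint_ray => // n; have [] := bP n.
have cv : quarter_form (b n).1 (b n).2 @[n --> \oo] --> quarter_form +oo%E +oo%E.
  apply: cvgD; apply: cvgM; try exact: cvg_cst.
    apply: cvgD; first exact: cvgM.
    by apply: cvgM; [exact: cvg_cst|exact: cvgM].
  by apply: cvgD; exact: cvgM.
have := cvgr_gt _ cv _ quarter_form_limit_gt.
case=> N _ /(_ N (leqnn N))/=; have [_ _ +] := bP N.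
by rewrite leNgt => /negP.
Qed.

End excess.

(** * Gaussian waves in several variables *)

Section tuple_waves.
Context (R : realType) (a : R).
Hypothesis a0 : 0 < a.
Implicit Types (d : nat) (th : R).

Definition twave d (c s : 'I_d -> R) th (t : d.-tuple R) : R :=
  expR (\sum_j (c j * tnth t j - a * tnth t j ^+ 2)) * cos (th + \sum_j s j * tnth t j).

Lemma measurable_twave d (c s : 'I_d -> R) th : measurable_fun setT (twave c s th).
Proof.
have mt j : measurable_fun setT (fun t : d.-tuple R => tnth t j) by exact: measurable_tnth.
apply: measurable_funM.
  apply: measurableT_comp => //; apply: measurable_sum => j.
  apply: measurable_funB; first exact: measurable_funM.
  by apply: measurable_funM => //; exact: measurable_funX.
apply: (measurableT_comp (f := cos)).
  by apply: continuous_measurable_fun; exact: continuous_cos.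
apply: measurable_funD => //; apply: measurable_sum => j.
exact: measurable_funM.
Qed.

Lemma twave_cons d (c s : 'I_d.+1 -> R) th (p : measurableTypeR R * d.-tuple R) :
  twave c s th (consT p) =
  gwave a (c ord0) (s ord0) th 0 p.1 * twave (c \o lift ord0) (s \o lift ord0) 0 p.2
  + (- 1) * (gwave a (c ord0) (s ord0) (th - pi / 2) 0 p.1
    * twave (c \o lift ord0) (s \o lift ord0) (- (pi / 2)) p.2).
Proof.
case: p => x t; rewrite /twave /gwave !big_ord_recl /=.
have tl j : tnth (consT (x, t)) (lift ord0 j) = tnth t j by rewrite tnthS.
under eq_bigr do rewrite tl.
under [X in _ + (_ + X)]eq_bigr do rewrite tl.
rewrite (_ : tnth (consT (x, t)) ord0 = x)//.
rewrite expRD addrA [in LHS]cosD add0r.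
rewrite [th - _ + _]addrAC cosBpihalf [- _ + _]addrC cosBpihalf.
by rewrite expr0; ring.
Qed.

(** Induction on the dimension: the addition formula splits a wave in d + 1 variables
    into two products of a wave on the line and a wave in d variables.  The free
    phase makes both products instances of the induction hypothesis. *)
Lemma integral_twave d (c s : 'I_d -> R) th :
  (lebesgue_tuple R d).-integrable setT (EFin \o twave c s th) /\
  \int[lebesgue_tuple R d]_t twave c s th t = Num.sqrt (pi / a) ^+ d
    * expR (\sum_j (c j ^+ 2 - s j ^+ 2) / (4 * a)) * cos (th + \sum_j s j * c j / (2 * a)).
Proof.
elim: d c s th => [|d IH] c s th.
  have mE := measurable_twave c s th.
  have iE : (lebesgue_tuple R 0).-integrable setT (EFin \o twave c s th).
    apply/integrableP; split; first exact/measurable_EFinP.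
    rewrite /= integral_dirac//; last first.
      by apply/measurable_EFinP; exact: measurableT_comp.
    by rewrite diracT mul1e ltry.
  split=> //; rewrite /Rintegral /= integral_dirac//; last exact/measurable_EFinP.
  by rewrite diracT mul1e /= /twave !big_ord0 expr0 mul1r.
set c' := c \o lift ord0; set s' := s \o lift ord0.
pose A th' (x : measurableTypeR R) := gwave a (c ord0) (s ord0) th' 0 x.
pose B th' := twave c' s' th'.
have iA th' : (@lebesgue_measure R).-integrable setT (EFin \o A th').
  exact: (integrable_gspan a0 (gspan_wave _ _ _ _ _)).
have iB th' := (IH c' s' th').1.
have iP t1 t2 := integrable_prod_measure (iA t1) (iB t2).
pose m := (@lebesgue_measure R \x lebesgue_tuple R d)%E.
have EP t1 t2 : \int[m]_p (A t1 p.1 * B t2 p.2)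
    = (\int[@lebesgue_measure R]_x A t1 x) * (\int[lebesgue_tuple R d]_t B t2 t).
  exact: Rintegral_prod_measure.
have E : (EFin \o twave c s th) \o @consT R d =
    (fun p => ((A th p.1 * B 0 p.2)%:E + (- 1)%:E * (A (th - pi / 2) p.1 * B (- (pi / 2)) p.2)%:E)%E).
  by apply/funext => p; rewrite /= twave_cons EFinD EFinM.
have iC : m.-integrable setT ((EFin \o twave c s th) \o @consT R d).
  by rewrite E; apply: integrableD => //; exact: integrableZl.
have mE : measurable_fun setT (EFin \o twave c s th) by apply/measurable_EFinP; exact: measurable_twave.
split.
  exact: (integrable_pushforward (@measurable_consT R d) mE iC measurableT).
rewrite /Rintegral (_ : (\int[lebesgue_tuple R d.+1]_t (twave c s th t)%:E)%E =
    (\int[m]_p ((EFin \o twave c s th) \o @consT R d) p)%E); last first.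
  exact: (integral_pushforward (@measurable_consT R d) mE iC measurableT).
rewrite E.
rewrite -[LHS]/(\int[m]_p (A th p.1 * B 0 p.2 + (- 1) * (A (th - pi / 2) p.1 * B (- (pi / 2)) p.2))).
have iZ : m.-integrable setT
    (EFin \o (fun p => (- 1) * (A (th - pi / 2) p.1 * B (- (pi / 2)) p.2))).
  exact: (@integrableZl _ _ _ m setT measurableT (- 1) _ (iP _ _)).
rewrite RintegralD//; [|exact: iP].
rewrite RintegralZl//; last exact: iP.
rewrite !EP /B !(IH _ _ _).2 /A !Rintegral_gwave//.
rewrite !big_ord_recl [in RHS]exprS [in RHS]expRD [in RHS]addrA [in RHS]cosD.
rewrite [th - _ + _]addrAC cosBpihalf [- (_ / _) + _]addrC cosBpihalf add0r.
rewrite /c' /s' /=; ring.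
Qed.

End tuple_waves.

(** * The Wigner function of the two-packet state *)

Section plane_waves.
Context (R : realType) (h : R).
Hypothesis h0 : 0 < h.
Let a := h^-1.
Let a0 : 0 < a. Proof. by rewrite invr_gt0. Qed.
Variables (d : nat) (k : 'rV[R]_d).
Hypothesis k1 : edot k k = 1.
Implicit Types (z zeta : 'rV[R]_d) (t : d.-tuple R).

Lemma edotDr (x y z : 'rV[R]_d) : edot x (y + z) = edot x y + edot x z.
Proof. by rewrite -big_split; apply: eq_bigr => j _; rewrite mxE mulrDr. Qed.

Lemma edotBr (x y z : 'rV[R]_d) : edot x (y - z) = edot x y - edot x z.
Proof. by rewrite -sumrB; apply: eq_bigr => j _; rewrite !mxE mulrBr. Qed.

(** The waves met in a Wigner integral, where the frequency is a combination of the
    direction k of the state and of the momentum variable zeta. *)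
Definition pwave (al be ga th : R) zeta t : R :=
  expR (al * edot k (rV_of_tuple t)
    - a * edot (rV_of_tuple t) (rV_of_tuple t))
  * cos (th + (be * edot k (rV_of_tuple t) + ga * edot zeta (rV_of_tuple t))).

Lemma pwaveE al be ga th zeta : pwave al be ga th zeta
  = twave a (fun j => al * k 0 j) (fun j => be * k 0 j + ga * zeta 0 j) th.
Proof.
apply/funext => t; rewrite /pwave /twave /edot !mulr_sumr -sumrB -big_split/=.
by congr (expR _ * cos (_ + _)); apply: eq_bigr => j _; rewrite !mxE; ring.
Qed.

Lemma integral_pwave al be ga th zeta :
  (lebesgue_tuple R d).-integrable setT (EFin \o pwave al be ga th zeta) /\
  (pi * h) `^ (- (d%:R / 2)) * \int[lebesgue_tuple R d]_t pwave al be ga th zeta t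
  = expR (h / 4 * (al ^+ 2 - be ^+ 2 - 2 * be * ga * edot k zeta - ga ^+ 2 * edot zeta zeta))
    * cos (th + h / 2 * al * (be + ga * edot k zeta)).
Proof.
rewrite pwaveE; have [? ->] := integral_twave a0 (fun j => al * k 0 j)
  (fun j => be * k 0 j + ga * zeta 0 j) th; split => //.
have h' : h != 0 by rewrite gt_eqF.
rewrite /a invrK -[X in _ * X = _]mulrA.
have ph : 0 < pi * h by rewrite mulr_gt0 ?pi_gt0.
have -> : (pi * h) `^ (- (d%:R / 2)) * (Num.sqrt (pi * h) ^+ d *
    (expR (\sum_j ((al * k 0 j) ^+ 2 - (be * k 0 j + ga * zeta 0 j) ^+ 2) / (4 / h)) *
     cos (th + \sum_j (be * k 0 j + ga * zeta 0 j) * (al * k 0 j) / (2 / h)))) =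
    expR (\sum_j ((al * k 0 j) ^+ 2 - (be * k 0 j + ga * zeta 0 j) ^+ 2) / (4 / h)) *
     cos (th + \sum_j (be * k 0 j + ga * zeta 0 j) * (al * k 0 j) / (2 / h)).
  rewrite mulrA; have -> : Num.sqrt (pi * h) ^+ d = (pi * h) `^ (d%:R / 2).
    rewrite -powR12_sqrt ?ltW// -powR_mulrn ?powR_ge0// -powRrM.
    by congr (_ `^ _); rewrite mulrC.
  by rewrite -powRD ?addNr ?powRr0 ?mul1r// (gt_eqF ph) implybT.
congr (expR _ * cos (_ + _)).
  transitivity (h / 4 * ((al ^+ 2 - be ^+ 2) * edot k k - 2 * be * ga * edot k zeta - ga ^+ 2 * edot zeta zeta)).
    rewrite /edot !mulr_sumr -!sumrB mulr_sumr; apply: eq_bigr => j _; field.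
    by [].
  by rewrite k1 mulr1.
transitivity (h / 2 * al * (be * edot k k + ga * edot k zeta)).
  rewrite /edot !mulr_sumr -!big_split mulr_sumr; apply: eq_bigr => j _ /=; field.
  by [].
by rewrite k1 mulr1.
Qed.

End plane_waves.

Section wigner.
Context (R : realType) (h : R).
Hypothesis h0 : 0 < h.
Let kap : R := momentum h^-1.
Local Notation del := (@mixing R).

(** Real and imaginary parts of exp ((1 + i) kap s) + del * exp (- (1 + i) kap s). *)
Definition profile (s : R) : R[i] :=
  (cos (kap * s) * (expR (kap * s) + del * expR (- (kap * s))))
  +i* (sin (kap * s) * (expR (kap * s) - del * expR (- (kap * s)))).

(** The Wigner function of the profile, with exp (2 kap (x + y)) and
    cos (2 kap (x - y)) split into products of functions of x and of y. *)
Definition wigner_profile (x y : R) : R :=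
  (@cnorm R)^-1 * (expR (2 * kap * x) * expR (2 * kap * y)
    + del ^+ 2 * (expR (- (2 * kap) * x) * expR (- (2 * kap) * y)))
  + 2 * del * @cnorm R * (cos (2 * kap * x) * cos (2 * kap * y)
    + sin (2 * kap * x) * sin (2 * kap * y)).

Lemma profile_mul_conj x b : profile (x + b) * conjc (profile (x - b)) =
  ((expR (2 * kap * x) + del ^+ 2 * expR (- (2 * kap * x))) * cos (2 * kap * b)
   + del * (expR (2 * kap * b) + expR (- (2 * kap * b))) * cos (2 * kap * x))
  +i* ((expR (2 * kap * x) - del ^+ 2 * expR (- (2 * kap * x))) * sin (2 * kap * b)
   + del * (expR (2 * kap * b) - expR (- (2 * kap * b))) * sin (2 * kap * x)).
Proof.
rewrite /profile; set X := kap * (x + b); set Y := kap * (x - b).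
have -> : 2 * kap * x = X + Y by rewrite /X /Y; ring.
have -> : 2 * kap * b = X - Y by rewrite /X /Y; ring.
rewrite !opprD !opprK !expRD !cosD !sinD !cosN !sinN.
by apply/eqP; rewrite eq_complex /=; apply/andP; split; apply/eqP; ring.
Qed.

(** The integrand is a combination of four waves, one for each pair of exponentials, so
    the integral follows from [integral_pwave].  The factor exp (|zeta| ^ 2 / h) cancels
    the zeta-Gaussian, which is why only the component of zeta along k remains.  The
    imaginary part is the same combination with the phase - pi / 2, and vanishes. *)
Lemma wignerE_profile d (k z zeta : 'rV[R]_d) : edot k k = 1 ->
  wignerE h (fun x => profile (edot k x)) (fun x => profile (edot k x)) z zeta
  = (wigner_profile (edot k z) (edot k zeta))%:C.
Proof.
move=> k1; set x := edot k z; set y := edot k zeta.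
have h' : h != 0 by rewrite gt_eqF.
have kap2 : kap ^+ 2 = 100 / h.
  by rewrite /kap /momentum exprMn sqr_sqrtr ?invr_ge0 ?ltW//; congr (_ * _); ring.
pose N := (pi * h) `^ (- (d%:R / 2)).
pose comb th (t : d.-tuple R) : R := expR (2 * kap * x) * pwave h k 0 (2 * kap) (- (2 / h)) th zeta t
  + (del ^+ 2 * expR (- (2 * kap * x)) * pwave h k 0 (- (2 * kap)) (- (2 / h)) th zeta t
  + (del * pwave h k (2 * kap) 0 (- (2 / h)) (th + 2 * kap * x) zeta t
  + del * pwave h k (- (2 * kap)) 0 (- (2 / h)) (th - 2 * kap * x) zeta t)).
have combE th : (lebesgue_tuple R d).-integrable setT (EFin \o comb th) /\
    expR (edot zeta zeta / h) * (N * \int[lebesgue_tuple R d]_t comb th t)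
    = wigner_profile x y * cos th.
  have P al be t' := integral_pwave h0 k1 al be (- (2 / h)) t' zeta.
  have iZ r al be t' : (lebesgue_tuple R d).-integrable setT
      (EFin \o (fun s => r * pwave h k al be (- (2 / h)) t' zeta s)).
    exact: (@integrableZl _ _ _ (lebesgue_tuple R d) setT measurableT r _ (P _ _ _).1).
  have iD f g : (lebesgue_tuple R d).-integrable setT (EFin \o f) ->
      (lebesgue_tuple R d).-integrable setT (EFin \o g) ->
      (lebesgue_tuple R d).-integrable setT (EFin \o (fun s => f s + g s)).
    by move=> fi gi; exact: (integrableD measurableT fi gi).
  split; first by apply: (iD) => //; apply: (iD) => //; exact: (iD).
  rewrite /comb RintegralD//; last by apply: (iD) => //; exact: (iD).
  rewrite RintegralD//; last exact: (iD).
  rewrite RintegralD// !RintegralZl//; try exact: (P _ _ _).1.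
  rewrite [N * _]mulrDr [N * (_ + (_ + _))]mulrDr [N * (_ + _)]mulrDr.
  rewrite !(mulrCA N) !(P _ _ _).2 -/y; set S := edot zeta zeta / h.
  have kap2' : kap * kap = 100 / h by rewrite -expr2.
  (* An opaque name for 100, since expRD would split expR 100 into factors expR 1. *)
  have [c cE] : {c : R | c = 100} by exists 100.
  have e1 : h / 4 * (0 ^+ 2 - (2 * kap) ^+ 2 - 2 * (2 * kap) * - (2 / h) * y
      - (- (2 / h)) ^+ 2 * edot zeta zeta) = - c + 2 * kap * y - S.
    by rewrite /S cE exprMn kap2; field.
  have e2 : h / 4 * (0 ^+ 2 - (- (2 * kap)) ^+ 2 - 2 * (- (2 * kap)) * - (2 / h) * y
      - (- (2 / h)) ^+ 2 * edot zeta zeta) = - c - 2 * kap * y - S.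
    by rewrite /S cE sqrrN exprMn kap2; field.
  have e3 : h / 4 * ((2 * kap) ^+ 2 - 0 ^+ 2 - 2 * 0 * - (2 / h) * y
      - (- (2 / h)) ^+ 2 * edot zeta zeta) = c - S.
    by rewrite /S cE exprMn kap2; field.
  have e4 : h / 4 * ((- (2 * kap)) ^+ 2 - 0 ^+ 2 - 2 * 0 * - (2 / h) * y
      - (- (2 / h)) ^+ 2 * edot zeta zeta) = c - S.
    by rewrite /S cE sqrrN exprMn kap2; field.
  have c3 : h / 2 * (2 * kap) * (0 + - (2 / h) * y) = - (2 * kap * y) by field.
  have c4 : h / 2 * (- (2 * kap)) * (0 + - (2 / h) * y) = 2 * kap * y by field.
  rewrite e1 e2 e3 e4 c3 c4 !mulr0 !mul0r !addr0 /wigner_profile.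
  rewrite /cnorm -cE !mulNr !expRD !expRN !cosD !sinD !cosN !sinN.
  have nz u : expR u != 0 :> R by rewrite gt_eqF ?expR_gt0.
  by field; rewrite !nz.
transitivity ((expR (edot zeta zeta / h))%:C * cintegral (lebesgue_tuple R d)
    (fun s => (N * comb 0 s) +i* (N * comb (- (pi / 2)) s))).
  rewrite /wignerE; congr (_ * cintegral _ _).
  apply/funext => s; set t := rV_of_tuple s => /=.
  rewrite edotDr edotBr -[expi _ * _ * _]mulrA profile_mul_conj -/x /comb /pwave -/t.
  have -> : - (2 / h) * edot zeta t = - (2 * edot zeta t / h) by ring.
  have -> : - edot t t / h = - (h^-1 * edot t t) by ring.
  rewrite /expi -/N !mul0r !add0r -!addrA ![- (pi / 2) + _]addrC !cosBpihalf !mulNr.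
  rewrite !expRD !cosD !sinD !cosN !sinN.
  by apply/eqP; rewrite eq_complex /=; apply/andP; split; apply/eqP; ring.
rewrite /cintegral /=.
rewrite !RintegralZl//; [|exact: (combE _).1..].
apply/eqP; rewrite eq_complex /= !mul0r subr0 addr0 !(combE _).2.
by rewrite cos0 mulr1 eqxx cosN cos_pihalf mulr0 eqxx.
Qed.
End wigner.

(** * The Gaussian law on the line *)

Section law_with_density.
Context d (T : measurableType d) (R : realType) (mu : {measure set T -> \bar R}).
Local Notation leb := (@lebesgue_measure R).
Variables (X : T -> measurableTypeR R) (rho : R -> R).
Hypothesis mX : measurable_fun setT X.
Hypothesis mrho : measurable_fun setT rho.
Hypothesis rho_ge0 : forall x, 0 <= rho x.
Hypothesis XE : forall A, measurable A ->
  mu (X @^-1` A) = (\int[leb]_(x in A) (rho x)%:E)%E.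

Lemma law_with_densityP (g : R -> R) : measurable_fun setT g ->
  leb.-integrable setT (EFin \o (g \* rho)) ->
  mu.-integrable setT (EFin \o (g \o X)) /\
  \int[mu]_y g (X y) = \int[leb]_x (g x * rho x).
Proof.
move=> mg ig.
pose nu0 : {measure set (measurableTypeR R) -> \bar R} := pushforward mu X.
pose nu := nu0 mX.
have nuE A : measurable A -> nu A = (\int[leb]_(x in A) (rho x)%:E)%E by exact: XE.
have inu : nu.-integrable setT (EFin \o g).
  exact: (@integrable_density _ (measurableTypeR R) R leb nu rho mrho rho_ge0 nuE g mg ig).
have mEg : measurable_fun setT (EFin \o g) by exact/measurable_EFinP.
have imu : mu.-integrable setT ((EFin \o g) \o X).
  apply/integrableP; split; first exact: measurableT_comp.
  move/integrableP : inu => [_]; apply: le_lt_trans.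
  by rewrite (ge0_integral_pushforward mX)//; exact: measurableT_comp.
split => //.
rewrite -(@Rintegral_density _ (measurableTypeR R) R leb nu rho mrho rho_ge0 nuE g mg) /Rintegral; congr fine.
exact/esym/(integral_pushforward mX mEg imu measurableT).
Qed.

End law_with_density.

Section gauss1.
Context (R : realType) (h : R).
Hypothesis h0 : 0 < h.
Local Notation leb := (@lebesgue_measure R).

Definition gdens (x : R) : R := (Num.sqrt (pi * h))^-1 * gwave h^-1 0 0 0 0 x.

Lemma gauss_density_line (x : R) : gauss_density (h / 2) [tuple of x :: [tuple]] = gdens x.
Proof.
rewrite /gauss_density big_ord_recl big_ord0 /= /gdens /gwave.
have ph : 0 < pi * h by rewrite mulr_gt0 ?pi_gt0.
rewrite (_ : 2 * pi * (h / 2) = pi * h); last by field.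
rewrite powRN div1r powR12_sqrt ?(ltW ph)// expr0 !mul0r !addr0 cos0 mulr1 mul1r.
congr (_ * expR _); rewrite (_ : tnth _ ord0 = x)//; field.
by rewrite gt_eqF.
Qed.

Lemma measurable_gdens : measurable_fun setT gdens.
Proof. by apply: measurable_funM => //; exact: (measurable_gspan (gspan_wave _ _ _ _ _)). Qed.

Lemma gdens_ge0 x : 0 <= gdens x.
Proof.
rewrite mulr_ge0 ?invr_ge0// /gwave expr0 !mul0r addr0 cos0 mulr1 mul1r.
exact: expR_ge0.
Qed.

Lemma gauss_line (A : set R) : measurable A ->
  gauss (h / 2) [set t : 1.-tuple R | A (thead t)] = (\int[leb]_(x in A) (gdens x)%:E)%E.
Proof.
move=> mA; pose D := [set t : 1.-tuple R | A (thead t)].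
have mth : measurable_fun setT (fun t : 1.-tuple R => thead t).
  exact: (@measurable_tnth _ _ 1 ord0).
have mD : measurable D by rewrite -[D]setTI; exact: mth.
have E (t : 1.-tuple R) : gauss_density (h / 2) t = gdens (thead t).
  case: t => -[//|x [|//]] i; rewrite -gauss_density_line.
  by congr gauss_density; exact/val_inj.
rewrite /gauss -/D; under eq_integral do rewrite E.
have mg : measurable_fun setT (fun t : 1.-tuple R => (gdens (thead t))%:E).
  by apply/measurable_EFinP; apply: measurableT_comp mth; exact: measurable_gdens.
rewrite integral_mkcond.
rewrite (_ : (\int[lebesgue_tuple R 1]_t ((fun t : 1.-tuple R => (gdens (thead t))%:E) \_ D) t)%E =
  (\int[(leb \x lebesgue_tuple R 0)%E]_p
    ((((fun t : 1.-tuple R => (gdens (thead t))%:E) \_ D) \o @consT R 0) p))%E); last first.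
  apply: (ge0_integral_pushforward (@measurable_consT R 0)) => //.
    exact: ((measurable_restrictT _ mD).1 (measurable_funTS mg)).
  move=> t _; rewrite patchE; case: ifP => // _; rewrite lee_fin; exact: gdens_ge0.
have mc : measurable_fun setT (((fun t : 1.-tuple R => (gdens (thead t))%:E) \_ D) \o @consT R 0).
  apply: measurableT_comp; last exact: measurable_consT.
  exact: ((measurable_restrictT _ mD).1 (measurable_funTS mg)).
rewrite fubini_tonelli1; first last.
- move=> p; rewrite /= patchE; case: ifP => // _; rewrite lee_fin; exact: gdens_ge0.
- exact: mc.
rewrite [RHS]integral_mkcond; apply: eq_integral => x _.
rewrite /fubini_F /= integral_dirac//; last first.
  exact: (measurableT_comp mc (@pair1_measurable _ _ _ _ x)).
rewrite diracT mul1e !patchE.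
by rewrite (_ : thead _ = x)//.
Qed.

End gauss1.

(** * Linear forms on the Wiener space and uniqueness of cylindrical representations *)

Section scalar_forms.
Context (R : realType) (V : lmodType R) (f : V -> R).
Hypothesis lf : scalar f.

Lemma scalar_form0 : f 0 = 0.
Proof. by have := lf (-1) 0 0; rewrite scaler0 addr0 mulN1r addNr. Qed.

Lemma scalar_formZ a x : f (a *: x) = a * f x.
Proof. by have := lf a x 0; rewrite addr0 scalar_form0 addr0. Qed.

Lemma scalar_formD x y : f (x + y) = f x + f y.
Proof. by have := lf 1 x y; rewrite scale1r mul1r. Qed.

Lemma scalar_form_sum d (c : 'I_d -> R) (u : 'I_d -> V) :
  f (\sum_j c j *: u j) = \sum_j c j * f (u j).
Proof.
rewrite (big_morph f scalar_formD scalar_form0).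
by apply: eq_bigr => j _; rewrite scalar_formZ.
Qed.

End scalar_forms.

Section wiener.
Context (R : realType) (W : wienerSpace R).
Local Notation H := (wH W).

(** Two continuous forms that agree on the dense image of the Hilbert space agree. *)
Lemma represents_unique (e : H) (l1 l2 : wB W -> R) :
  represents e l1 -> represents e l2 -> l1 = l2.
Proof.
move=> [_ c1 E1] [_ c2 E2]; apply/funext => x; apply: contrapT => /eqP nx.
have cl : continuous (fun x => l1 x - l2 x).
  by move=> z; apply: cvgB; [exact: c1|exact: c2].
pose O := (fun x => l1 x - l2 x) @^-1` [set r | r != 0].
have oO : open O.
  by move/continuousP : cl; apply; exact: open_neq.
have [|y [+ [z _ zy]]] := @iota_dense _ W O _ oO.
  by exists x; rewrite /O/= subr_eq0.
by rewrite /O/= -zy E1 E2 subrr eqxx.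
Qed.

Lemma represents_ell (e : H) : in_dual e -> represents e (ell e).
Proof. by move=> ?; exact: (@xgetPex _ _ [set l | represents e l]). Qed.

Lemma ell_iota (e : H) x : in_dual e -> ell e (Defs.iota W x) = dot e x.
Proof. by move=> /represents_ell[]. Qed.

Lemma measurable_ell (e : H) : in_dual e ->
  measurable_fun setT (ell e : borelB W -> measurableTypeR R).
Proof.
move=> /represents_ell[_ ce _].
apply: (measurability _ (RGenOpens.measurableE R)).
move=> _ [_ [a [b ->] <-]]; rewrite setTI.
apply: sub_sigma_algebra.
by move/continuousP : ce; apply; exact: interval_open.
Qed.

Section direction.
Variables (h : R) (e1 : H).
Hypothesis h0 : 0 < h.
Hypothesis he1 : in_dual e1.
Hypothesis e1_norm : `|e1| = 1.

Let dot11 : dot e1 e1 = 1.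
Proof. by rewrite dot_norm e1_norm expr1n. Qed.

Lemma dual_basis_line : dual_basis (fun _ : 'I_1 => e1).
Proof. by split=> // i j; rewrite dot11 !ord1 eqxx. Qed.

Section law.
Variable mu : probability (borelB W) R.
Hypothesis hmu : is_wiener_measure (h / 2) mu.

Lemma ell_law (A : set (measurableTypeR R)) : measurable A ->
  mu ((ell e1 : borelB W -> measurableTypeR R) @^-1` A)
  = (\int[@lebesgue_measure R]_(x in A) (gdens h x)%:E)%E.
Proof.
move=> mA; rewrite -gauss_line//.
have mth : measurable_fun setT (fun t : 1.-tuple R => thead t).
  exact: (@measurable_tnth _ _ 1 ord0).
pose D := [set t : 1.-tuple R | A (thead t)].
have mD : measurable D by rewrite -[D]setTI; exact: mth.
have pm : is_protomeasure (H := H) (h / 2) [set x | D [tuple dot e1 x | i < 1]] (gauss (h / 2) D).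
  by exists 1%N, (fun _ : 'I_1 => e1), D; split => //; exact: dual_basis_line.1.
rewrite -(@hmu 1%N (fun _ : 'I_1 => e1) D _ (fun _ => he1) mD pm).
congr (mu _); apply/seteqP; split => y; rewrite /D/= /thead tnth_mktuple//.
Qed.

Let a0 : 0 < h^-1. Proof. by rewrite invr_gt0. Qed.

Lemma gaussian_expectation (D : set R) c s t : measurable D ->
  mu.-integrable setT (EFin \o (fun y : borelB W => \1_D (ell e1 y) * gwave 0 c s t 0 (ell e1 y))) /\
  \int[mu]_y (\1_D (ell e1 y) * gwave 0 c s t 0 (ell e1 y)) = gint h^-1 D c s t.
Proof.
move=> mD; pose g x := \1_D x * gwave 0 c s t 0 x.
have mg : measurable_fun setT g.
  by apply: measurable_funM => //; exact: (measurable_gspan (gspan_wave _ _ _ _ _)).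
(* The density turns the exponential waves, of Gaussian rate 0, into waves of rate 1 / h. *)
have iw : (@lebesgue_measure R).-integrable setT (EFin \o gwave h^-1 c s t 0).
  exact: (integrable_gspan a0 (gspan_wave _ _ _ _ _)).
have E : g \* gdens h = fun x => (Num.sqrt (pi * h))^-1 * (\1_D x * gwave h^-1 c s t 0 x).
  apply/funext => x; rewrite /g /gdens /= /gwave !expr0 !mul0r !subr0 !add0r cos0 !mul1r !mulr1.
  by rewrite expRD; ring.
have iE : (@lebesgue_measure R).-integrable setT (EFin \o (fun x => \1_D x * gwave h^-1 c s t 0 x)).
  apply: (le_integrable _ _ _ iw) => //.
    apply/measurable_EFinP; apply: measurable_funM => //.
    exact: (measurable_gspan (gspan_wave _ _ _ _ _)).
  move=> x _; rewrite lee_fin /= normrM ler_piMl// indicE.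
  by case: (_ \in _); rewrite ?normr1 ?normr0.
have ig : (@lebesgue_measure R).-integrable setT (EFin \o (g \* gdens h)).
  by rewrite E; exact: (integrableZl measurableT (Num.sqrt (pi * h))^-1 iE).
have [i ->] := law_with_densityP (measurable_ell he1) (measurable_gdens h) (gdens_ge0 h) ell_law mg ig.
split => //.
rewrite -[LHS]/(\int[@lebesgue_measure R]_x ((g \* gdens h) x)) E RintegralZl//.
rewrite /gint invrK; congr (_ * _); rewrite [RHS]Rintegral_mkcond.
apply: eq_Rintegral => x _; rewrite patchE indicE.
by case: (_ \in _); rewrite ?mul1r ?mul0r.
Qed.

End law.

Section representation.
Variables (d : nat) (u : 'I_d -> H) (phi : 'rV[R]_d -> R[i]).
Hypothesis hu : dual_basis u.
Hypothesis hphi : profile h \o ell e1 = phi \o tpi u :> (borelB W -> R[i]).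
Let k : 'rV[R]_d := \row_j dot e1 (u j).

Let hphiE y : profile h (ell e1 y) = phi (tpi u y).
Proof. exact: (congr1 (fun f => f y) hphi). Qed.

Let tpi_iota x : tpi u (Defs.iota W x) = \row_j dot (u j) x.
Proof. by apply/rowP => j; rewrite !mxE ell_iota//; exact: hu.2. Qed.

Let dotlC (y : H) : scalar (fun x => dot y x).
Proof. by move=> a x z; rewrite !(dotC y); exact: dot_linear. Qed.

(** Let r be the component of e1 orthogonal to u.  Along r the state depends on
    ell e1 but phi \o tpi u is constant, so r <> 0 would make the profile constant;
    but its real part is 1 + del at 0 and vanishes at pi / (2 kap). *)
Lemma direction_in_span : e1 = \sum_j k 0 j *: u j.
Proof.
apply/eqP; rewrite -subr_eq0; set r := e1 - _; apply: contrapT => /negP r0.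
have ur j : dot (u j) r = 0.
  rewrite dotC /r (scalar_formD (dot_linear (u j))) -scaleN1r (scalar_formZ (dot_linear (u j))).
  rewrite (scalar_form_sum (dot_linear (u j))) (bigD1 j)//= big1 => [|i ij].
    by rewrite hu.1 eqxx mulr1 addr0 mxE mulN1r subrr.
  by rewrite hu.1 (negbTE ij) mulr0.
have rr : dot e1 r = dot r r.
  have : dot e1 r = dot (r + \sum_j k 0 j *: u j) r by rewrite /r subrK.
  move=> ->; rewrite (scalar_formD (dot_linear r)) (scalar_form_sum (dot_linear r)).
  by rewrite big1 ?addr0// => j _; rewrite ur mulr0.
have nr : dot r r != 0 by rewrite dot_norm expf_eq0/= normr_eq0.
have cst s : profile h s = phi 0.
  (* Moving along r realises every value of ell e1 at zero coordinates in u. *)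
  have <- : ell e1 (Defs.iota W ((s / dot r r) *: r)) = s.
    by rewrite ell_iota// (scalar_formZ (dotlC e1)) rr divfK.
  rewrite hphiE; congr phi; rewrite tpi_iota; apply/rowP => j.
  by rewrite !mxE (scalar_formZ (dotlC (u j))) ur mulr0.
have kap0 : momentum h^-1 != 0 :> R by rewrite gt_eqF// momentum_gt0// invr_gt0.
have := cst (pi / 2 / momentum h^-1); rewrite -(cst 0) /profile.
have -> : momentum h^-1 * (pi / 2 / momentum h^-1) = pi / 2 :> R.
  by rewrite mulrC divfK.
rewrite cos_pihalf mul0r mulr0 cos0 oppr0 expR0 mul1r mulr1 => -[/eqP + _].
by rewrite eq_sym gt_eqF// addr_gt0// mixing_gt0.
Qed.

Lemma direction_unit : edot k k = 1.
Proof.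
rewrite -dot11 {1}direction_in_span (scalar_form_sum (dot_linear e1)).
by apply: eq_bigr => j _; rewrite mxE dotC.
Qed.

Lemma ell_direction y : ell e1 y = edot k (tpi u y).
Proof.
have rj j := represents_ell (hu.2 j).
(* Both sides represent e1, and the representing form is unique. *)
suff : represents e1 (fun y => edot k (tpi u y)).
  by move=> /(represents_unique (represents_ell he1)) ->.
split.
- move=> a x z; rewrite /edot mulr_sumr -big_split; apply: eq_bigr => j _ /=.
  by rewrite !mxE; have [lj _ _] := rj j; rewrite lj; ring.
- rewrite (_ : (fun y => _) = (fun y => \sum_j (k 0 j * ell (u j) y))); last first.
    by apply/funext => x; apply: eq_bigr => j _; rewrite !mxE.
  move=> x; apply: cvg_big => [|j _]; first exact: add_continuous.
  apply: cvgM; first exact: cvg_cst.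
  by have [_ cj _] := rj j; exact: cj.
- move=> x; rewrite tpi_iota [in RHS]direction_in_span (scalar_form_sum (dot_linear x)).
  by apply: eq_bigr => j _; rewrite !mxE.
Qed.

Lemma profile_direction : phi = (fun x => profile h (edot k x)).
Proof.
apply/funext => x.
have E : tpi u (Defs.iota W (\sum_j x 0 j *: u j)) = x.
  rewrite tpi_iota; apply/rowP => i; rewrite mxE (scalar_form_sum (dotlC (u i))).
  rewrite (bigD1 i)//= big1 => [|j ji]; first by rewrite hu.1 eqxx mulr1 addr0.
  by rewrite hu.1 eq_sym (negbTE ji) mulr0.
by rewrite -{1}E -hphiE ell_direction E.
Qed.

End representation.

End direction.
End wiener.

(** * The two-packet profile is a test function *)

Section schwartz_line.
Context (R : realType) (a : R).
Hypothesis a0 : 0 < a.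

(** In dimension one every iterated partial derivative is an iterated derivative, and
    the span of the Gaussian waves is stable under derivation. *)
Lemma partials_gspan (l : seq 'I_1) (F : R -> R) : gspan a F ->
  exists2 G, gspan a G & partials l (fun y : 'rV[R]_1 => F (y 0 0)) = (fun y => G (y 0 0)).
Proof.
move=> sF; elim: l => [|i l [G sG E]]; first by exists F.
have [G' sG' dG] := is_derive_gspan sG; exists G' => //=.
rewrite E; apply/funext => x.
have [_ <-] := dG (x 0 0).
apply: (congr1 (fun f : R -> R => lim (f r @[r --> 0^']))); apply/funext => r /=.
by rewrite !mxE !ord1 !eqxx.
Qed.

Lemma norm_rV1 (x : 'rV[R]_1) : `|x| <= `|x 0 0|.
Proof.
rewrite [leLHS]/Num.norm /= mx_normrE; apply: bigmax_le => // -[i j] _ /=.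
by rewrite !ord1.
Qed.

Lemma schwartz_gspan (F : R -> R) : gspan a F -> schwartz (fun y : 'rV[R]_1 => F (y 0 0)).
Proof.
move=> sF l; have [G sG ->] := partials_gspan l sF; split=> [x|k].
  apply: (@differentiable_comp _ _ _ _ (fun y : 'rV[R]_1 => y 0 0) G).
    exact: differentiable_coord.
  have [G' _ dG] := is_derive_gspan sG.
  by apply/derivable1_diffP; have [] := dG (x 0 0).
have [M MP] := gspan_bounded k a0 sG; exists M => x.
apply: le_trans (MP (x 0 0)); rewrite ler_wpM2r//.
by rewrite lerXn2r ?nnegrE// norm_rV1.
Qed.

End schwartz_line.

Section profile_state.
Context (R : realType) (h : R).
Hypothesis h0 : 0 < h.

Lemma test_fun_profile : test_fun h (fun y : 'rV[R]_1 => profile h (y 0 0)).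
Proof.
have a0 : 0 < (2 * h)^-1 by rewrite invr_gt0 mulr_gt0.
pose kap := momentum h^-1.
pose F t (m : R) x := (pi * h) `^ (- (1%:R / 4)) *
  (gwave (2 * h)^-1 kap kap t 0 x + m * gwave (2 * h)^-1 (- kap) kap t 0 x).
have sF t m : gspan (2 * h)^-1 (F t m).
  apply: gspan_scale; apply: gspan_add; first exact: gspan_wave.
  by apply: gspan_scale; exact: gspan_wave.
have edot1 (y : 'rV[R]_1) : edot y y = y 0 0 ^+ 2.
  by rewrite /edot big_ord_recl big_ord0 addr0.
split.
  rewrite (_ : (fun y => _) = (fun y : 'rV[R]_1 => F 0 (mixing R) (y 0 0))); last first.
    apply/funext => y; rewrite /gamma_fun /profile /= edot1 /F /gwave -/kap !expr0 !mul0r subr0 add0r.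
    rewrite (_ : - y 0 0 ^+ 2 / (2 * h) = - ((2 * h)^-1 * y 0 0 ^+ 2)); last by ring.
    by rewrite mulNr !expRD; ring.
  exact: (schwartz_gspan a0 (sF _ _)).
rewrite (_ : (fun y => _) = (fun y : 'rV[R]_1 => F (- (pi / 2)) (- mixing R) (y 0 0))); last first.
  apply/funext => y; rewrite /gamma_fun /profile /= edot1 /F /gwave -/kap !expr0 !mul0r addr0.
  rewrite (_ : - y 0 0 ^+ 2 / (2 * h) = - ((2 * h)^-1 * y 0 0 ^+ 2)); last by ring.
  by rewrite !mulNr !expRD [- (pi / 2) + _]addrC cosBpihalf; ring.
exact: (schwartz_gspan a0 (sF _ _)).
Qed.

Lemma sqmod_profile s : sqmod (profile h s) =
  gwave 0 (2 * momentum h^-1) 0 0 0 s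
  + (mixing R ^+ 2 * gwave 0 (- (2 * momentum h^-1)) 0 0 0 s
  + 2 * mixing R * gwave 0 0 (2 * momentum h^-1) 0 0 s).
Proof.
rewrite /sqmod /profile /=; set K := momentum h^-1; set E := expR _; set E' := expR (- _).
have EE' : E * E' = 1 by rewrite -expRD subrr expR0.
rewrite /gwave !expr0 !mul0r !subr0 !addr0 add0r cos0 !mul1r !mulr1 expR0 mul1r.
have -> : expR (2 * K * s) = E * E by rewrite -expRD; congr expR; ring.
have -> : expR (- (2 * K) * s) = E' * E' by rewrite -expRD; congr expR; ring.
have -> : cos (2 * K * s) = cos (K * s) ^+ 2 - sin (K * s) ^+ 2.
  by rewrite (_ : 2 * K * s = K * s + K * s) ?cosD -?expr2//; ring.
rewrite [(cos _ * _) ^+ 2]exprMn [(sin _ * _) ^+ 2]exprMn sin2cos2; set C := cos _ ^+ 2.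
have -> : (E + mixing R * E') ^+ 2 = E * E + 2 * mixing R * (E * E') + mixing R ^+ 2 * (E' * E') by ring.
have -> : (E - mixing R * E') ^+ 2 = E * E - 2 * mixing R * (E * E') + mixing R ^+ 2 * (E' * E') by ring.
by rewrite EE'; ring.
Qed.

End profile_state.

(** * Evaluation of the quadratic form *)

Section two_packets.
Context (R : realType) (W : wienerSpace R) (h : R)
  (mu : probability (borelB W) R) (e1 : wH W).
Hypotheses (h0 : 0 < h) (hmu : is_wiener_measure (h / 2) mu)
  (he1 : in_dual e1) (e1_norm : `|e1| = 1).
Let kap : R := momentum h^-1.
Let a0 : 0 < h^-1. Proof. by rewrite invr_gt0. Qed.

Definition packets : borelB W -> R[i] := profile h \o ell e1.

Lemma packets_tpi : packets = (fun y : 'rV[R]_1 => profile h (y 0 0)) \o tpi (fun _ : 'I_1 => e1).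
Proof. by apply/funext => y; rewrite /packets /= mxE. Qed.

Lemma cylindrical_packets : cylindrical h packets.
Proof.
exists 1%N, (fun _ => e1), (fun y : 'rV[R]_1 => profile h (y 0 0)); split.
- exact: dual_basis_line.
- exact: test_fun_profile.
- exact: packets_tpi.
Qed.

(** Whatever representation is selected, its two functions are the profile composed with
    the scalar product by a unit vector, and its coordinates recover ell e1. *)
Lemma wignerB_packets p :
  wignerB h packets packets p = (wigner_profile h (ell e1 p.1) (ell e1 p.2))%:C.
Proof.
pose phi1 (y : 'rV[R]_1) := profile h (y 0 0).
pose P := [set w : borelB W * borelB W -> R[i] |
  exists (d : nat) (u : 'I_d -> wH W) (phi psi : 'rV[R]_d -> R[i]),
    [/\ dual_basis u, test_fun h phi /\ test_fun h psi,
        packets = phi \o tpi u, packets = psi \o tpi u &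
        w = fun p => wignerE h phi psi (tpi u p.1) (tpi u p.2)]].
have exP : exists w, P w.
  eexists; exists 1%N, (fun _ => e1), phi1, phi1; split; last reflexivity.
  - exact: dual_basis_line.
  - by split; exact: test_fun_profile.
  - exact: packets_tpi.
  - exact: packets_tpi.
have [d [u [phi [psi [hu _ E1 E2 ->]]]]] : P (wignerB h packets packets) := xgetPex _ exP.
rewrite (profile_direction h0 he1 hu E1) (profile_direction h0 he1 hu E2).
rewrite wignerE_profile//; last exact: (direction_unit h0 he1 e1_norm hu E1).
by rewrite -!(ell_direction h0 he1 hu E1).
Qed.

Let K D c s t (y : borelB W) : R := \1_D (ell e1 y) * gwave 0 c s t 0 (ell e1 y).

Let iK D c s t : measurable D -> mu.-integrable setT (EFin \o K D c s t).
Proof. by move=> mD; exact: (gaussian_expectation h0 he1 e1_norm hmu c s t mD).1. Qed.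

Let EK D c s t : measurable D -> \int[mu]_y K D c s t y = gint h^-1 D c s t.
Proof. by move=> mD; exact: (gaussian_expectation h0 he1 e1_norm hmu c s t mD).2. Qed.

Let sqmodE : (fun y => sqmod (packets y)) = (fun y => K setT (2 * kap) 0 0 y
  + (mixing R ^+ 2 * K setT (- (2 * kap)) 0 0 y + 2 * mixing R * K setT 0 (2 * kap) 0 y)).
Proof.
by apply/funext => y; rewrite /packets /= sqmod_profile /K indicT !mul1r.
Qed.

Let iZ r f : mu.-integrable setT (EFin \o f) -> mu.-integrable setT (EFin \o (fun y => r * f y)).
Proof. by move=> i; exact: (integrableZl measurableT r i). Qed.

Let iD f g : mu.-integrable setT (EFin \o f) -> mu.-integrable setT (EFin \o g) ->
  mu.-integrable setT (EFin \o (fun y => f y + g y)).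
Proof. by move=> fi gi; exact: (integrableD measurableT fi gi). Qed.

Lemma isL2_packets : isL2 mu packets.
Proof.
have mX := measurable_ell he1.
have mc : measurable_fun setT (@cos R) by apply: continuous_measurable_fun; exact: continuous_cos.
have ms : measurable_fun setT (@sin R) by apply: continuous_measurable_fun; exact: continuous_sin.
have mk : measurable_fun setT (fun s : R => kap * s) by exact: measurable_funM.
have me : measurable_fun setT (fun s : R => expR (kap * s)) by exact: measurableT_comp.
have me' : measurable_fun setT (fun s : R => mixing R * expR (- (kap * s))).
  by apply: measurable_funM => //; apply: measurableT_comp => //; exact: measurableT_comp.
split.
- apply: (measurableT_comp (f := fun s : R => complex.Re (profile h s))) mX.
  by apply: measurable_funM; [exact: (measurableT_comp mc mk)|exact: measurable_funD].
- apply: (measurableT_comp (f := fun s : R => complex.Im (profile h s))) mX.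
  by apply: measurable_funM; [exact: (measurableT_comp ms mk)|exact: measurable_funB].
- rewrite -[X in integrable _ _ X]/(EFin \o (fun y => sqmod (packets y))) sqmodE.
  by apply: iD; [exact: iK|apply: iD; apply: iZ; exact: iK].
Qed.

Let kap2 : (2 * kap) ^+ 2 / (4 * h^-1) = 100.
Proof.
rewrite /kap /momentum !exprMn sqr_sqrtr ?(ltW a0)//; field.
by rewrite gt_eqF.
Qed.

Lemma sqnormL2_packets : sqnormL2 mu packets = state_norm2 R.
Proof.
rewrite /sqnormL2 sqmodE RintegralD//; [|exact: iK|by apply: iD; apply: iZ; exact: iK].
rewrite RintegralD//; [|by apply: iZ; exact: iK..].
rewrite !RintegralZl//; [|exact: iK..].
rewrite !EK// !gintT// expr0n/= !mul0r !mulr0 !subr0 sub0r !addr0 cos0 sqrrN !mulr1 mulNr.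
by rewrite kap2 expRN /state_norm2 -/(cnorm R) !mul0r addr0 cos0; ring.
Qed.

(** The symbol and each term of the Wigner function are products of a function of ell e1 z
    and a function of ell e1 zeta, so Fubini reduces the form to one-dimensional
    expectations. *)
Lemma Qweyl_packets (a : \bar R) : Qweyl mu h (Fa e1 h a) packets packets
  = (quarter_form h^-1 ((2 * pi * h)%:E * a)%E a)%:C.
Proof.
pose D1 := ray ((2 * pi * h)%:E * a)%E; pose D2 := ray a.
have m1 : measurable D1 := measurable_ray _.
have m2 : measurable D2 := measurable_ray _.
pose T c s t p : R := K D1 c s t p.1 * K D2 c s t p.2.
have iT c s t : (mu \x mu)%E.-integrable setT (EFin \o T c s t).
  exact: (integrable_prod_measure (iK c s t m1) (iK c s t m2)).
have ET c s t : \int[(mu \x mu)%E]_p T c s t p = gint h^-1 D1 c s t * gint h^-1 D2 c s t.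
  by rewrite (Rintegral_prod_measure (iK c s t m1) (iK c s t m2)) !EK.
have iZ2 r f : (mu \x mu)%E.-integrable setT (EFin \o f) ->
    (mu \x mu)%E.-integrable setT (EFin \o (fun y => r * f y)).
  by move=> i; exact: (integrableZl measurableT r i).
have iD2 f g : (mu \x mu)%E.-integrable setT (EFin \o f) ->
    (mu \x mu)%E.-integrable setT (EFin \o g) ->
    (mu \x mu)%E.-integrable setT (EFin \o (fun y => f y + g y)).
  by move=> fi gi; exact: (integrableD measurableT fi gi).
pose w p := (cnorm R)^-1 * (T (2 * kap) 0 0 p + mixing R ^+ 2 * T (- (2 * kap)) 0 0 p)
  + 2 * mixing R * cnorm R * (T 0 (2 * kap) 0 p + T 0 (2 * kap) (- (pi / 2)) p).
have -> : Qweyl mu h (Fa e1 h a) packets packets = (\int[(mu \x mu)%E]_p w p) +i* 0.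
  rewrite /Qweyl (_ : (fun p => _) = (fun p => (w p)%:C)); last first.
    apply/funext => p; rewrite wignerB_packets /Fa -rmorphM /=; congr (_%:C).
    rewrite -/(ray a) -/(ray ((2 * pi * h)%:E * a)%E) -/D1 -/D2.
    rewrite /w /T /K /wigner_profile -/kap /gwave !expr0 !mul0r !subr0 !addr0 !add0r cos0 expR0.
    rewrite ![- (pi / 2) + _]addrC !cosBpihalf; ring.
  rewrite /cintegral /=; congr (_ +i* _).
  by rewrite /Rintegral integral0.
congr (_ +i* _).
rewrite /w RintegralD//; last 2 first.
- by apply: (iZ2); apply: (iD2) => //; exact: (iZ2).
- by apply: (iZ2); exact: (iD2).
rewrite !RintegralZl//; last 2 first.
- by apply: (iD2) => //; exact: (iZ2).
- exact: (iD2).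
rewrite !RintegralD//; last exact: (iZ2).
by rewrite RintegralZl// !ET.
Qed.

End two_packets.

Unset Implicit Arguments.

Theorem proposition1p10 (R : realType) (W : wienerSpace R) (h : R)
    (mu : probability (borelB W) R) (e1 : wH W)
    (h_gt0 : 0 < h) (hmu : is_wiener_measure (h / 2) mu)
    (he1 : in_dual e1) (e1_norm : `|e1| = 1) :
  exists2 A : R, 0 < A &
    forall a : \bar R, (A%:E <= a)%E ->
      exists v : borelB W -> R[i],
        [/\ isL2 mu v, cylindrical h v &
            (sqnormL2 mu v)%:C < Qweyl mu h (Fa e1 h a) v v].
Proof.
have a0 : 0 < h^-1 by rewrite invr_gt0.
have [A A0 HA] := quarter_form_gt a0.
have ph : 0 < 2 * pi * h by rewrite !mulr_gt0// pi_gt0.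
exists (Num.max A (A / (2 * pi * h))); first by rewrite lt_max A0.
move=> a; rewrite EFin_max ge_max => /andP[a1 a2].
exists (packets h e1); split.
- exact: isL2_packets.
- exact: cylindrical_packets.
- rewrite sqnormL2_packets// Qweyl_packets// ltcR; apply: HA => //.
  have -> : A%:E = ((2 * pi * h)%:E * (A / (2 * pi * h))%:E)%E.
    by rewrite -EFinM mulrC divfK// gt_eqF.
  by rewrite lee_wpmul2l// lee_fin ltW.
Qed.
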